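(* Let $\mathcal{Q}$ be an augmented PMQ with completion $\hat{\mathcal{Q}}$. Then the total monodromy $\hat\omega\colon\mathrm{Hur}^{\Delta}(\mathcal{Q})\to\hat{\mathcal{Q}}$, the unique map of $\hat{\mathcal{Q}}$-crossed spaces to the discrete space $\hat{\mathcal{Q}}$, induces a bijection on connected components.
   Context: A quandle (with unit) is a set $\mathcal{Q}$ with an element $\mathbf{1}\in\mathcal{Q}$ (unit) and a binary operation $(a,b)\mapsto a^b$ (conjugation) such that: $(-)^a\colon\mathcal{Q}\to\mathcal{Q}$ is bijective for all $a$; $\mathbf{1}^a=\mathbf{1}$ and $a^{\mathbf{1}}=a$; $a^a=a$; $(a^b)^c=(a^c)^{(b^c)}$ for all $a,b,c$. A partial monoid is a set $M$ with an element $\mathbf{1}$, a subset $D\subseteq M\times M$ and a map $D\to M$, $(a,b)\mapsto ab$ (one says $ab$ is defined if $(a,b)\in D$), such that $\mathbf{1}a$ and $a\mathbf{1}$ are defined and equal to $a$, and for all $a,b,c$: ($ab$ and $(ab)c$ are defined) if and only if ($bc$ and $a(bc)$ are defined), in which case $(ab)c=a(bc)$. A PMQ is a set $\mathcal{Q}$ that is both a quandle and a partial monoid with the same unit, such that for all $a,b,c$: (1) $ab$ is defined iff $b(a^b)$ is defined, and then $ab=b(a^b)$; (2) $a^{(bc)}=(a^b)^c$ whenever $bc$ is defined; (3) $ab$ is defined iff $(a^c)(b^c)$ is defined, and then $(ab)^c=(a^c)(b^c)$. Maps of PMQs preserve unit, conjugation and defined products. A PMQ is complete if all products are defined. The completion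 $\hat{\mathcal{Q}}$ is initial among complete PMQs receiving a map of PMQs from $\mathcal{Q}$; as a monoid it is generated by $\hat a$, $a\in\mathcal{Q}$, with relations $\hat{\mathbf{1}}=\mathbf{1}$, $\hat a\hat b=\widehat{ab}$ when $ab$ is defined, and $\hat a\hat b=\hat b\,\widehat{a^b}$. The map $\mathcal{Q}\to\hat{\mathcal{Q}}$ is injective and $\mathcal{Q}$ is regarded as a subset of $\hat{\mathcal{Q}}$. $\mathcal{Q}$ is augmented if $\mathcal{Q}_+:=\mathcal{Q}\setminus\{\mathbf{1}\}$ is an ideal, i.e. closed under all conjugations $(-)^b$ and their inverses, and whenever $a\in\mathcal{Q}_+$, $b\in\mathcal{Q}$, each of $ab$, $ba$ lies in $\mathcal{Q}_+$ if defined; then $\hat{\mathcal{Q}}$ is augmented too. $\mathrm{Arr}(\mathcal{Q})$ is the bisimplicial set whose $(p,q)$-bisimplices are arrays $\underline a=(a_{i,j})_{0\le i\le p+1,\,0\le j\le q+1}$ with entries in $\hat{\mathcal{Q}}$ ($i$ indexes columns, $j$ indexes rows). The horizontal degeneracy $s_i^{\mathrm{hor}}$ ($0\le i\le p$) inserts a column of $\mathbf{1}$'s between columns $i$ and $i+1$; the vertical degeneracy $s_j^{\mathrm{ver}}$ ($0\le j\le q$) inserts a row of $\mathbf{1}$'s between rows $j$ and $j+1$. The horizontal face $d_i^{\mathrm{hor}}$ ($p\ge1$, $0\le i\le p$) replaces columns $i,i+1$ by one column with $j$-th entry $a_{i,j}^{c_j}\,a_{i+1,j}$, where $c_j=a_{i+1,0}a_{i+1,1}\cdots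 a_{i+1,j-1}$ ($c_0=\mathbf{1}$); the vertical face $d_j^{\mathrm{ver}}$ ($q\ge1$, $0\le j\le q$) replaces rows $j,j+1$ by one row with $i$-th entry $a_{i,j}a_{i,j+1}$. An array is admissible if (1) $a_{i,j}=\mathbf{1}$ whenever $i\in\{0,p+1\}$ or $j\in\{0,q+1\}$, and (2) all entries lie in $\mathcal{Q}\subset\hat{\mathcal{Q}}$. Non-admissible arrays form a bisimplicial subset $\mathrm{NAdm}(\mathcal{Q})\subset\mathrm{Arr}(\mathcal{Q})$. The simplicial Hurwitz space is $\mathrm{Hur}^{\Delta}(\mathcal{Q}):=|\mathrm{Arr}(\mathcal{Q})|\setminus|\mathrm{NAdm}(\mathcal{Q})|$ (difference of geometric realisations of bisimplicial sets, subspace topology). A $\hat{\mathcal{Q}}$-crossed space is a space that is a disjoint union of spaces $X(a)$, $a\in\hat{\mathcal{Q}}$, with maps $(-)^b\colon X(a)\to X(a^b)$ satisfying $((-)^b)^c=(-)^{bc}$. On $\mathrm{Hur}^\Delta(\mathcal{Q})$ the element $b$ acts by conjugating all entries of arrays, and the cell of an array $\underline a$ lies in grading $(a_{0,0}a_{0,1}\cdots a_{0,q+1})(a_{1,0}\cdots a_{1,q+1})\cdots(a_{p+1,0}\cdots a_{p+1,q+1})$; thus $\hat\omega$ sends each point of this cell to this product. *)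

(* Defs.v *)
From HB Require Import structures.
From Stdlib Require Import Relation_Operators.
From mathcomp Require Import all_boot all_order all_algebra generic_quotient.
From mathcomp Require Import all_classical all_reals all_analysis.
From mathcomp Require Import zify.
Set Implicit Arguments.
Unset Strict Implicit.
Unset Printing Implicit Defensive.
Import Order.TTheory GRing.Theory Num.Theory.
Import numFieldNormedType.Exports.

Local Open Scope classical_set_scope.

Declare Scope pmq_scope.
Delimit Scope pmq_scope with pmq.

HB.mixin Record hasUnit1 (T : Type) := { qone : T }.

#[short(type="unitalType")]
HB.structure Definition Unital := {T of Choice T & hasUnit1 T}.

Notation "1" := (qone) : pmq_scope.

(* [qconj a b] is the conjugate a^b. *)
HB.mixin Record isQuandle T of Unital T := {
  qconj : T -> T -> T;
  qconj_bij : forall b, bijective (qconj^~ b);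
  qconj1x : forall b, qconj qone b = qone;
  qconjx1 : forall a, qconj a qone = a;
  qconjxx : forall a, qconj a a = a;
  qconj_conj : forall a b c,
    qconj (qconj a b) c = qconj (qconj a c) (qconj b c)
}.

#[short(type="quandleType")]
HB.structure Definition Quandle := {T of Unital T & isQuandle T}.

Notation "a ^ b" := (qconj a b) : pmq_scope.

(* [qpmul a b] is [Some (ab)] when ab is defined and [None] otherwise; an
   equality between two such options says that one product is defined if and
   only if the other is, and that the values then agree. *)
HB.mixin Record isPartialMonoid T of Unital T := {
  qpmul : T -> T -> option T;
  qpmul1x : forall a, qpmul qone a = Some a;
  qpmulx1 : forall a, qpmul a qone = Some a;
  qpmulA : forall a b c d,
    (exists2 ab, qpmul a b = Some ab & qpmul ab c = Some d) <->
    (exists2 bc, qpmul b c = Some bc & qpmul a bc = Some d)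
}.

#[short(type="partialMonoidType")]
HB.structure Definition PartialMonoid := {T of Unital T & isPartialMonoid T}.

HB.mixin Record Quandle_PartialMonoid_isPMQ T
    of Quandle T & PartialMonoid T := {
  qpmulC : forall a b : T, qpmul a b = qpmul b (qconj a b);
  qconjM : forall a b c bc : T,
    qpmul b c = Some bc -> qconj a bc = qconj (qconj a b) c;
  qconj_pmul : forall a b c : T,
    omap (qconj^~ c) (qpmul a b) = qpmul (qconj a c) (qconj b c)
}.

#[short(type="pmqType")]
HB.structure Definition PMQ :=
  {T of Quandle T & PartialMonoid T & Quandle_PartialMonoid_isPMQ T}.

HB.mixin Record isCompletePMQ T of PMQ T := {
  qmul : T -> T -> T;
  qpmulE : forall a b, qpmul a b = Some (qmul a b)
}.

#[short(type="completePMQType")]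
HB.structure Definition CompletePMQ := {T of PMQ T & isCompletePMQ T}.

Notation "a * b" := (qmul a b) : pmq_scope.

Local Open Scope pmq_scope.

Definition pmq_map (Q Q' : pmqType) (f : Q -> Q') : Prop :=
  [/\ f 1 = 1,
      forall a b, f (a ^ b) = f a ^ f b
    & forall a b c, qpmul a b = Some c -> qpmul (f a) (f b) = Some (f c)].

Record completion (Q : pmqType) := Completion {
  completion_sort :> completePMQType;
  completion_map : Q -> completion_sort;
  completion_map_pmq : pmq_map completion_map;
  completion_initial : forall (M : completePMQType) (f : Q -> M), pmq_map f ->
    exists! g : completion_sort -> M, pmq_map g /\ g \o completion_map = f
}.

Definition pmq_ideal (Q : pmqType) (I : set Q) : Prop :=
  [/\ forall a b, I a -> I (a ^ b),
      forall a b, I (a ^ b) -> I a,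
      forall a b ab, I a -> qpmul a b = Some ab -> I ab
    & forall a b ba, I a -> qpmul b a = Some ba -> I ba].

Definition augmented (Q : pmqType) : Prop := pmq_ideal [set a : Q | a <> 1].

Section CompletePMQTheory.
Variable M : completePMQType.
Implicit Types a b c : M.

Lemma qmulA : associative (@qmul M).
Proof.
move=> a b c; have [_ h] := qpmulA a b c (a * (b * c)).
case: h => [|ab]; first by exists (b * c); rewrite qpmulE.
by rewrite !qpmulE => -[<-] [].
Qed.

Lemma qmul1x : left_id (1 : M) qmul.
Proof. by move=> a; have := qpmul1x a; rewrite qpmulE => -[]. Qed.

Lemma qmulx1 : right_id (1 : M) qmul.
Proof. by move=> a; have := qpmulx1 a; rewrite qpmulE => -[]. Qed.

Lemma qmulC a b : a * b = b * (a ^ b).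
Proof. by have := qpmulC a b; rewrite !qpmulE => -[]. Qed.

Lemma qconjMr a b c : a ^ (b * c) = (a ^ b) ^ c.
Proof. by apply: qconjM; rewrite qpmulE. Qed.

Lemma qconjMl a b c : (a * b) ^ c = (a ^ c) * (b ^ c).
Proof. by have := qconj_pmul a b c; rewrite !qpmulE => -[]. Qed.

Lemma qconj_inj c : injective (qconj^~ c : M -> M).
Proof. exact/bij_inj/qconj_bij. Qed.

End CompletePMQTheory.

HB.instance Definition _ (M : completePMQType) :=
  Monoid.isLaw.Build M 1 qmul (@qmulA M) (@qmul1x M) (@qmulx1 M).

Section SubPMQ.
Variables (M : completePMQType) (S : set M).

Definition subpmq_closed : Prop :=
  [/\ S 1, forall a b, S a -> S b -> S (a * b),
      forall a b, S a -> S b -> S (a ^ b)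
    & forall a b, S b -> S (a ^ b) -> S a].

Hypothesis clS : subpmq_closed.

Definition subpmq of subpmq_closed : Type := set_type S.
Local Notation T := (subpmq clS).

HB.instance Definition _ := Choice.on T.

Let inT x (Sx : S x) : T := exist _ x (mem_set Sx).
Let Tin (x : T) : S (val x) := set_valP x.
Let T_inj (x y : T) : val x = val y -> x = y. Proof. exact: val_inj. Qed.

Let t1 : T := inT (let: And4 h _ _ _ := clS in h).
Let tmul (x y : T) : T :=
  inT (let: And4 _ h _ _ := clS in h _ _ (Tin x) (Tin y)).
Let tconj (x y : T) : T :=
  inT (let: And4 _ _ h _ := clS in h _ _ (Tin x) (Tin y)).

HB.instance Definition _ := hasUnit1.Build T t1.

Let tconj_bij y : bijective (tconj^~ y).
Proof.
have [g gK Kg] := @qconj_bij M (val y).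
have Sg (x : T) : S (g (val x)).
  have [_ _ _] := clS; apply; first exact: (Tin y).
  rewrite Kg; exact: Tin.
exists (fun x : T => inT (Sg x)) => x; apply: T_inj => /=.
  exact: gK.
exact: Kg.
Qed.

Let tconj1 b : tconj t1 b = t1. Proof. by apply: T_inj; exact: qconj1x. Qed.
Let tconjr1 a : tconj a t1 = a. Proof. by apply: T_inj; exact: qconjx1. Qed.
Let tconjaa a : tconj a a = a. Proof. by apply: T_inj; exact: qconjxx. Qed.
Let tconjJ a b c : tconj (tconj a b) c = tconj (tconj a c) (tconj b c).
Proof. by apply: T_inj; exact: qconj_conj. Qed.

HB.instance Definition _ :=
  isQuandle.Build T tconj_bij tconj1 tconjr1 tconjaa tconjJ.

Let tpmul (x y : T) := Some (tmul x y).
Let tpmul1 a : tpmul t1 a = Some a.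
Proof. by congr Some; apply: T_inj; exact: qmul1x. Qed.
Let tpmulr1 a : tpmul a t1 = Some a.
Proof. by congr Some; apply: T_inj; exact: qmulx1. Qed.
Let tpmulA a b c d :
  (exists2 ab, tpmul a b = Some ab & tpmul ab c = Some d) <->
  (exists2 bc, tpmul b c = Some bc & tpmul a bc = Some d).
Proof.
have E : tmul a (tmul b c) = tmul (tmul a b) c by apply: T_inj; exact: qmulA.
by split=> -[x [<-] [<-]]; eexists; try reflexivity; rewrite /tpmul E.
Qed.

HB.instance Definition _ := isPartialMonoid.Build T tpmul1 tpmulr1 tpmulA.

Let tpmulC (a b : T) : qpmul a b = qpmul b (qconj a b).
Proof. by congr Some; apply: T_inj; exact: qmulC. Qed.
Let tconjM (a b c bc : T) :
  qpmul b c = Some bc -> qconj a bc = qconj (qconj a b) c.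
Proof. by move=> [<-]; apply: T_inj; exact: qconjMr. Qed.
Let tconj_pmul (a b c : T) :
  omap (qconj^~ c) (qpmul a b) = qpmul (qconj a c) (qconj b c).
Proof. by congr Some; apply: T_inj; exact: qconjMl. Qed.

HB.instance Definition _ :=
  Quandle_PartialMonoid_isPMQ.Build T tpmulC tconjM tconj_pmul.

Let tpmulE (a b : T) : qpmul a b = Some (tmul a b). Proof. by []. Qed.
HB.instance Definition _ := isCompletePMQ.Build T tpmulE.

Lemma subpmq_val : pmq_map (val : T -> M).
Proof. by split=> // a b c [<-]; rewrite qpmulE. Qed.

Lemma subpmq_lift (Q : pmqType) (f : Q -> M) : pmq_map f ->
  (forall x, S (f x)) -> exists2 g : Q -> T, pmq_map g & val \o g = f.
Proof.
move=> [f1 fJ fM] Sf; exists (fun x => inT (Sf x)); last exact/funext.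
split=> [|a b|a b c /fM]; first exact: T_inj.
  by apply: T_inj; exact: fJ.
by rewrite qpmulE => -[E]; congr Some; apply: T_inj.
Qed.

End SubPMQ.

Lemma completion_ind (Q : pmqType) (Qh : completion Q) (S : set Qh) :
  subpmq_closed S -> (forall a, S (completion_map Qh a)) -> forall x, S x.
Proof.
move=> clS SQ x.
have [g gm gE] := @subpmq_lift _ _ clS _ _ (completion_map_pmq Qh) SQ.
have [r [[[r1 rJ rM] rE] _]] := completion_initial Qh gm.
have [u [_ uU]] := completion_initial Qh (completion_map_pmq Qh).
have -> : x = val (r x); last exact: (set_valP (r x)).
have idE : u = id by apply: uU; split=> //; split.
have : u = val \o r; last by rewrite idE => /(congr1 (@^~ x)).
apply: uU; split; last by rewrite -compA rE.
split=> [|a b|a b c /rM] /=; first by rewrite r1.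
  by rewrite rJ.
by have [_ _ h] := subpmq_val clS; exact: h.
Qed.

Lemma completion_map_conj (Q : pmqType) (Qh : completion Q) (a b : Qh) :
  range (completion_map Qh) (a ^ b) <-> range (completion_map Qh) a.
Proof.
pose E := range (completion_map Qh); rewrite -/E.
pose S := [set b : Qh | forall a, E (a ^ b) = E a].
suff : S b by move=> ->.
have [_ eJ _] := completion_map_pmq Qh.
apply: (@completion_ind _ _ S) => [|x y]; last first.
  have [g gK Kg] := @qconj_bij Q x; apply/propext; split=> -[z _].
    by rewrite -[z]Kg eJ => /qconj_inj <-; exists (g z).
  by move=> <-; exists (z ^ x); rewrite // eJ.
split=> /= [x|x y hx hy z|x y hx hy z|x y hy hxy z].
- by rewrite qconjx1.
- by rewrite qconjMr hy hx.
- have [g gK Kg] := @qconj_bij _ y.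
  by rewrite -(Kg z) -qconj_conj !hy hx.
- by rewrite -(hy (z ^ x)) qconj_conj hxy hy.
Qed.

Section SequenceOperators.
Variables (T : Type) (op : T -> T -> T) (e : T).
Implicit Types (i j k : nat) (f : nat -> T).

Definition merge_at i f k : T :=
  if (k < i)%N then f k else if k == i then op (f i) (f i.+1) else f k.+1.

Definition insert_after i f k : T :=
  if (k <= i)%N then f k else if k == i.+1 then e else f k.-1.

Hypotheses (opA : associative op) (op1x : left_id e op) (opx1 : right_id e op).

Ltac cases_nat := rewrite /merge_at /insert_after;
  repeat (case: ifPn => ?); try (exfalso; lia);
  rewrite ?op1x ?opx1 ?opA; try by [repeat (f_equal; try lia)].

Lemma merge_merge i j f : (i < j)%N ->
  merge_at i (merge_at j f) = merge_at j.-1 (merge_at i f).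
Proof using opA. move=> ij; apply/funext => k; cases_nat. Qed.

Lemma merge_insert_lt i j f : (i < j)%N ->
  merge_at i (insert_after j f) = insert_after j.-1 (merge_at i f).
Proof using Type. move=> ij; apply/funext => k; cases_nat. Qed.

Lemma merge_insert_eq i f : merge_at i (insert_after i f) = f.
Proof using opx1. apply/funext => k; cases_nat. Qed.

Lemma merge_insert_eqS i f : merge_at i.+1 (insert_after i f) = f.
Proof using op1x. apply/funext => k; cases_nat. Qed.

Lemma merge_insert_gt i j f : (j.+1 < i)%N ->
  merge_at i (insert_after j f) = insert_after j (merge_at i.-1 f).
Proof using Type. move=> ij; apply/funext => k; cases_nat. Qed.

Lemma insert_insert i j f : (i <= j)%N ->
  insert_after i (insert_after j f) = insert_after j.+1 (insert_after i f).
Proof using Type. move=> ij; apply/funext => k; cases_nat. Qed.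

End SequenceOperators.

Record simplicial_identities (X : nat -> Type)
    (d : forall n, nat -> X n.+1 -> X n)
    (s : forall n, nat -> X n -> X n.+1) : Prop := {
  face_face : forall n i j (x : X n.+2), (i < j <= n.+2)%N ->
    d n i (d n.+1 j x) = d n j.-1 (d n.+1 i x);
  face_deg_lt : forall n i j (x : X n.+1), (i < j <= n.+1)%N ->
    d n.+1 i (s n.+1 j x) = s n j.-1 (d n i x);
  face_deg_eq : forall n i (x : X n), (i <= n)%N -> d n i (s n i x) = x;
  face_deg_eqS : forall n i (x : X n), (i <= n)%N -> d n i.+1 (s n i x) = x;
  face_deg_gt : forall n i j (x : X n.+1), (j.+1 < i <= n.+2)%N ->
    d n.+1 i (s n.+1 j x) = s n j (d n i.-1 x);
  deg_deg : forall n i j (x : X n), (i <= j <= n)%N ->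
    s n.+1 i (s n j x) = s n.+1 j.+1 (s n i x)
}.

(* The operators [d_i] and [s_i] are indexed by [nat]; only the indices
   [i <= p.+1] of the faces of a [p.+1]-simplex and [i <= p] of the
   degeneracies of a [p]-simplex are meaningful. *)
Record bisimplicialSet := BisimplicialSet {
  bisimplex :> nat -> nat -> choiceType;
  hface : forall p q, nat -> bisimplex p.+1 q -> bisimplex p q;
  hdeg : forall p q, nat -> bisimplex p q -> bisimplex p.+1 q;
  vface : forall p q, nat -> bisimplex p q.+1 -> bisimplex p q;
  vdeg : forall p q, nat -> bisimplex p q -> bisimplex p q.+1;
  horizontal_identities : forall q,
    @simplicial_identities (bisimplex^~ q) (fun p => @hface p q) (fun p => @hdeg p q);
  vertical_identities : forall p,
    @simplicial_identities (bisimplex p) (@vface p) (@vdeg p);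
  hface_vface : forall p q i j (x : bisimplex p.+1 q.+1),
    (i <= p.+1)%N -> (j <= q.+1)%N -> hface i (vface j x) = vface j (hface i x);
  hface_vdeg : forall p q i j (x : bisimplex p.+1 q),
    (i <= p.+1)%N -> (j <= q)%N -> hface i (vdeg j x) = vdeg j (hface i x);
  hdeg_vface : forall p q i j (x : bisimplex p q.+1),
    (i <= p)%N -> (j <= q.+1)%N -> hdeg i (vface j x) = vface j (hdeg i x);
  hdeg_vdeg : forall p q i j (x : bisimplex p q),
    (i <= p)%N -> (j <= q)%N -> hdeg i (vdeg j x) = vdeg j (hdeg i x)
}.

Definition bisimplicial_map (X Y : bisimplicialSet)
    (f : forall p q, X p q -> Y p q) : Prop :=
  [/\ forall p q i (x : X p.+1 q), (i <= p.+1)%N ->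
        f p q (hface i x) = hface i (f p.+1 q x),
      forall p q i (x : X p q), (i <= p)%N ->
        f p.+1 q (hdeg i x) = hdeg i (f p q x),
      forall p q j (x : X p q.+1), (j <= q.+1)%N ->
        f p q (vface j x) = vface j (f p q.+1 x)
    & forall p q j (x : X p q), (j <= q)%N ->
        f p q.+1 (vdeg j x) = vdeg j (f p q x)].

Lemma bisimplicial_map_inv (X Y : bisimplicialSet)
    (f : forall p q, X p q -> Y p q) (g : forall p q, Y p q -> X p q) :
  bisimplicial_map f -> (forall p q, cancel (f p q) (g p q)) ->
  (forall p q, cancel (g p q) (f p q)) -> bisimplicial_map g.
Proof.
move=> [fhf fhd fvf fvd] fK gK.
split=> p q i x ip; apply: (can_inj (@fK _ _)); rewrite gK.
- by rewrite fhf ?gK.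
- by rewrite fhd ?gK.
- by rewrite fvf ?gK.
- by rewrite fvd ?gK.
Qed.

Section StandardSimplex.
Variable R : realType.

Definition simplex n : set 'rV[R]_n.+1 :=
  [set s | (forall i, 0 <= s ord0 i)%R /\ (\sum_i s ord0 i = 1)%R].
Arguments simplex : clear implicits.

Definition pushforward m n (phi : 'I_m.+1 -> 'I_n.+1) (s : 'rV[R]_m.+1) :
    'rV[R]_n.+1 :=
  (\row_k \sum_(j | phi j == k) s ord0 j)%R.

Lemma pushforward_simplex m n (phi : 'I_m.+1 -> 'I_n.+1) (s : simplex m) :
  pushforward phi (val s) \in simplex n.
Proof.
have [s0 s1] := set_valP s; apply/mem_set; split=> [i|].
  by rewrite mxE; apply: sumr_ge0.
rewrite -[RHS]s1 (partition_big phi xpredT) //=.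
by apply: eq_bigr => k _; rewrite mxE.
Qed.

Definition simplex_map m n (phi : 'I_m.+1 -> 'I_n.+1) (s : simplex m) :
    simplex n :=
  exist _ (pushforward phi (val s)) (pushforward_simplex phi s).

(* [bump i] is the increasing map omitting i; [unbump i] is the nondecreasing
   surjection taking the value i twice. *)
Definition coface n i : simplex n -> simplex n.+1 :=
  simplex_map (fun j : 'I_n.+1 => inord (bump i j)).

Definition codeg n i : simplex n.+1 -> simplex n :=
  simplex_map (fun j : 'I_n.+2 => inord (unbump i j)).

End StandardSimplex.
Arguments simplex : clear implicits.

Section Realization.
Variables (R : realType) (X : bisimplicialSet).

Definition cells : Type :=
  {pq : nat * nat &
    (discrete_topology (X pq.1 pq.2) *
      (simplex R pq.1 * simplex R pq.2))%type}.
HB.instance Definition _ := Topological.on cells.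

Definition cell p q (x : X p q) (s : simplex R p) (t : simplex R q) : cells :=
  existT (fun pq : nat * nat =>
    (discrete_topology (X pq.1 pq.2) * (simplex R pq.1 * simplex R pq.2))%type)
  (p, q) (x, (s, t)).

Inductive cell_glue : cells -> cells -> Prop :=
| glue_hface p q i (x : X p.+1 q) s t : (i <= p.+1)%N ->
    cell_glue (cell (hface i x) s t) (cell x (coface i s) t)
| glue_hdeg p q i (x : X p q) s t : (i <= p)%N ->
    cell_glue (cell (hdeg i x) s t) (cell x (codeg i s) t)
| glue_vface p q j (x : X p q.+1) s t : (j <= q.+1)%N ->
    cell_glue (cell (vface j x) s t) (cell x s (coface j t))
| glue_vdeg p q j (x : X p q) s t : (j <= q)%N ->
    cell_glue (cell (vdeg j x) s t) (cell x s (codeg j t)).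

Definition glue_rel : rel cells :=
  fun y z => `[< clos_refl_sym_trans cells cell_glue y z >].

Lemma glue_rel_equiv : equiv_class_of glue_rel.
Proof.
split=> [y|y z|z y w].
- exact/asboolP/rst_refl.
- by apply/asboolP/asboolP; exact: rst_sym.
- by move=> /asboolP yz /asboolP zw; apply/asboolP; exact: rst_trans zw.
Qed.

Canonical glue_equiv := EquivRelPack glue_rel_equiv.

Definition realization : Type := quotient_topology {eq_quot glue_equiv}%qT.
HB.instance Definition _ := Topological.on realization.
HB.instance Definition _ := Quotient.on realization.

Definition point_of p q (x : X p q) (s : simplex R p) (t : simplex R q) :
  realization := (\pi_(realization) (cell x s t))%qT.

Lemma cell_glue_pi y z : cell_glue y z ->
  (\pi_(realization) y = \pi_(realization) z)%qT.
Proof. by move=> yz; apply/eqquotP/asboolP; exact: rst_step. Qed.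

Lemma cell_continuous p q (x : X p q) :
  continuous (fun st : simplex R p * simplex R q => cell x st.1 st.2).
Proof.
move=> -[s t] U [[V W] /= [nV [[V1 V2] /= [nV1 nV2] VW]] VU].
exists (V1, V2) => //= -[s' t'] V12; apply: (VU (x, (s', t'))); split => /=.
  exact: nbhs_singleton nV.
exact: VW.
Qed.

Lemma cells_continuous (Z : topologicalType) (g : cells -> Z) :
  (forall p q (x : X p q), continuous (fun st => g (cell x st.1 st.2))) ->
  continuous g.
Proof.
move=> cg [[p q] [x [s t]]] U nU.
have /= [[V W] /= [nV nW] VW] := cg p q x (s, t) U nU.
exists ([set x], [set st | V st.1 /\ W st.2]) => /=.
  split; first exact: discrete_set1.
  by exists (V, W).
by case=> x' [s' t'] /= [-> VWst]; exact: (VW (s', t')).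
Qed.

Definition descend (Z : Type) (g : cells -> Z) : realization -> Z := g \o repr.

Lemma descend_pi (Z : Type) (g : cells -> Z) :
  (forall y z, cell_glue y z -> g y = g z) ->
  forall y, descend g (\pi_(realization) y)%qT = g y.
Proof.
move=> gE y; rewrite /descend /=.
have : (\pi_(realization) (repr (\pi_(realization) y)) =
        \pi_(realization) y)%qT by rewrite reprK.
move: (repr _) => w /eqquotP/asboolP; elim=> [a b|a|a b _|a b c _ + _] //; first exact: gE.
by move=> -> ->.
Qed.

Lemma descend_continuous (Z : topologicalType) (g : cells -> Z) :
  (forall y z, cell_glue y z -> g y = g z) -> continuous g ->
  continuous (descend g).
Proof.
move=> gE cg; apply/quotient_continuous.
by rewrite (_ : _ \o _ = g) //; apply/funext => y; exact: descend_pi.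
Qed.

Lemma realization_ind (P : realization -> Prop) :
  (forall p q (x : X p q) s t, P (point_of x s t)) -> forall z, P z.
Proof.
by move=> h z; rewrite -[z]reprK; case: (repr z) => -[p q] [x [s t]]; exact: h.
Qed.

(* When [A] is closed under faces and degeneracies this is |A|, seen inside
   |X|. *)
Definition realization_sub (A : forall p q, set (X p q)) : set realization :=
  [set z | exists p q (x : X p q) s t, A p q x /\ z = point_of x s t].

End Realization.

Section RealizationMap.
Variables (R : realType) (X Y : bisimplicialSet).
Variable f : forall p q, X p q -> Y p q.

Let cells_map (y : cells R X) : cells R Y :=
  let: existT (p, q) (x, (s, t)) := y in cell (f x) s t.

Definition realization_map : realization R X -> realization R Y :=
  descend (fun y : cells R X => (\pi_(realization R Y) (cells_map y))%qT).

Hypothesis fB : bisimplicial_map f.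

Let cells_mapP (y z : cells R X) : cell_glue y z ->
  (\pi_(realization R Y) (cells_map y) =
   \pi_(realization R Y) (cells_map z))%qT.
Proof.
have [fhf fhd fvf fvd] := fB.
by case=> p q i x s t ip; apply: cell_glue_pi;
  rewrite /= ?fhf ?fhd ?fvf ?fvd //; constructor.
Qed.

Lemma realization_mapE p q (x : X p q) s t :
  realization_map (point_of x s t) = point_of (f x) s t.
Proof. exact: descend_pi. Qed.

Lemma realization_map_continuous : continuous realization_map.
Proof.
apply: descend_continuous; first exact: cells_mapP.
apply: cells_continuous => p q x /= st U nU.
have h := @pi_continuous (cells R Y) {eq_quot glue_equiv R Y}%qT
  (cell (f x) st.1 st.2) U nU.
exact: (@cell_continuous R Y p q (f x) st _ h).
Qed.

End RealizationMap.

Section Arrays.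
Variable M : completePMQType.
Implicit Types (f g : nat -> M) (F G : nat -> nat -> M).

Definition prefix_prod f l : M := \big[qmul/qone]_(m < l) f m.

(* The merge of two adjacent columns f, g; it is a monoid law on columns. *)
Definition col_mul f g : nat -> M := fun l => (f l ^ prefix_prod g l) * g l.

Lemma prefix_prodS f l : prefix_prod f l.+1 = prefix_prod f l * f l.
Proof. by rewrite /prefix_prod big_ord_recr. Qed.

Lemma prefix_prod0 f : prefix_prod f 0 = 1.
Proof. by rewrite /prefix_prod big_ord0. Qed.

Lemma prefix_prod1 l : prefix_prod (fun=> 1) l = 1.
Proof. by rewrite /prefix_prod big1. Qed.

Lemma prefix_col_mul f g l :
  prefix_prod (col_mul f g) l = prefix_prod f l * prefix_prod g l.
Proof.
elim: l => [|l IH]; first by rewrite !prefix_prod0 qmul1x.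
rewrite !prefix_prodS IH /col_mul -!qmulA; congr (_ * _).
by rewrite !qmulA -qmulC.
Qed.

Lemma col_mulA : associative col_mul.
Proof.
move=> f g h; apply/funext => l.
by rewrite {1 3 4}/col_mul prefix_col_mul /col_mul qconjMr qconjMl qmulA.
Qed.

Lemma col_mul1l : left_id (fun=> 1) col_mul.
Proof. by move=> f; apply/funext => l; rewrite /col_mul qconj1x qmul1x. Qed.

Lemma col_mul1r : right_id (fun=> 1) col_mul.
Proof.
by move=> f; apply/funext => l; rewrite /col_mul prefix_prod1 qconjx1 qmulx1.
Qed.

Lemma prefix_merge i f n : (i < n)%N ->
  prefix_prod (merge_at qmul i f) n = prefix_prod f n.+1.
Proof.
elim: n => // n IH; rewrite ltnS leq_eqVlt => /predU1P[->|ni].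
  rewrite !prefix_prodS {2}/merge_at ltnn eqxx -qmulA; congr (_ * _).
  by rewrite /prefix_prod; apply: eq_bigr => k _; rewrite /merge_at ltn_ord.
rewrite prefix_prodS IH // [RHS]prefix_prodS; congr (_ * _).
by rewrite /merge_at ltnNge (ltnW ni) /= gtn_eqF.
Qed.

Lemma prefix_insert i f n : (i < n)%N ->
  prefix_prod (insert_after 1 i f) n.+1 = prefix_prod f n.
Proof.
elim: n => // n IH; rewrite ltnS leq_eqVlt => /predU1P[->|ni].
  rewrite !prefix_prodS {2 3}/insert_after leqnn ltnn eqxx qmulx1.
  congr (_ * _); rewrite /prefix_prod; apply: eq_bigr => k _.
  by rewrite /insert_after ltnW.
rewrite prefix_prodS IH // [RHS]prefix_prodS; congr (_ * _).
by rewrite /insert_after leqNgt ltnS (ltnW ni) /= eqSS gtn_eqF.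
Qed.

(* The entry in column i and row j of an array a is [a i j]; thus columns are
   indexed by the first index of the matrix. *)
Definition arr p q := 'M[M]_(p.+2, q.+2).

Definition grid m n (a : 'M[M]_(m.+1, n.+1)) : nat -> nat -> M :=
  fun k l => a (inord k) (inord l).

Definition array m n F : 'M[M]_(m, n) := (\matrix_(k, l) F k l)%R.
Arguments array : clear implicits.

Definition arr_hface p q i (a : arr p.+1 q) : arr p q :=
  array _ _ (merge_at col_mul i (grid a)).

Definition arr_hdeg p q i (a : arr p q) : arr p.+1 q :=
  array _ _ (insert_after (fun=> 1) i (grid a)).

Definition arr_vface p q j (a : arr p q.+1) : arr p q :=
  array _ _ (fun k => merge_at qmul j (grid a k)).

Definition arr_vdeg p q j (a : arr p q) : arr p q.+1 :=
  array _ _ (fun k => insert_after 1 j (grid a k)).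

Lemma gridK m n (a : 'M[M]_(m.+1, n.+1)) : array _ _ (grid a) = a.
Proof. by apply/matrixP => k l; rewrite mxE /grid !inord_val. Qed.

Lemma grid_array m n F k l : (k <= m)%N -> (l <= n)%N ->
  grid (array m.+1 n.+1 F) k l = F k l.
Proof. by move=> km ln; rewrite /grid mxE !inordK. Qed.

Lemma array_eq m n F G :
  (forall k l, (k < m)%N -> (l < n)%N -> F k l = G k l) ->
  array m n F = array m n G.
Proof. by move=> FG; apply/matrixP => k l; rewrite !mxE FG. Qed.

Lemma arr_hface_array p q i F :
  arr_hface i (array p.+3 q.+2 F) = array _ _ (merge_at col_mul i F).
Proof.
apply: array_eq => k l kp lq; rewrite /merge_at.
case: ifP => [?|_]; first by rewrite grid_array //; lia.
case: eqP => [ki|_]; last by rewrite grid_array.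
rewrite /col_mul !grid_array //; try lia.
congr ((_ ^ _) * _); rewrite /prefix_prod; apply: eq_bigr => r _.
by rewrite grid_array //; case: r => r /=; lia.
Qed.

Lemma arr_hdeg_array p q i F : (i <= p)%N ->
  arr_hdeg i (array p.+2 q.+2 F) =
  array _ _ (insert_after (fun=> 1) i F).
Proof.
move=> ip; apply: array_eq => k l kp lq; rewrite /insert_after.
case: ifP => ?; first by rewrite grid_array //; lia.
by case: eqP => // ?; rewrite grid_array //; lia.
Qed.

Lemma arr_vface_array p q j F :
  arr_vface j (array p.+2 q.+3 F) =
  array _ _ (fun k => merge_at qmul j (F k)).
Proof.
apply: array_eq => k l kp lq; rewrite /merge_at.
case: ifP => ?; first by rewrite grid_array //; lia.
by case: eqP => ?; rewrite !grid_array //; lia.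
Qed.

Lemma arr_vdeg_array p q j F : (j <= q)%N ->
  arr_vdeg j (array p.+2 q.+2 F) =
  array _ _ (fun k => insert_after 1 j (F k)).
Proof.
move=> jq; apply: array_eq => k l kp lq; rewrite /insert_after.
case: ifP => ?; first by rewrite grid_array //; lia.
by case: eqP => // ?; rewrite grid_array //; lia.
Qed.

Let arrE := (arr_hface_array, arr_hdeg_array, arr_vface_array, arr_vdeg_array).

Lemma arr_horizontal q : @simplicial_identities (fun p => arr p q)
  (fun p => @arr_hface p q) (fun p => @arr_hdeg p q).
Proof.
split=> n; [move=> i j a|move=> i j a|move=> i a|move=> i a|move=> i j a|
  move=> i j a] => ij; rewrite -(gridK a) !arrE; try lia.
- by rewrite (merge_merge col_mulA) //; lia.
- by rewrite merge_insert_lt //; lia.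
- by rewrite (merge_insert_eq col_mul1r).
- by rewrite (merge_insert_eqS col_mul1l).
- by rewrite merge_insert_gt //; lia.
- by rewrite insert_insert //; lia.
Qed.

Lemma arr_vertical p : @simplicial_identities (arr p)
  (@arr_vface p) (@arr_vdeg p).
Proof.
split=> n; [move=> i j a|move=> i j a|move=> i a|move=> i a|move=> i j a|
  move=> i j a] => ij; rewrite -(gridK a) !arrE; try lia;
  congr array; apply/funext => k.
- by rewrite (merge_merge (@qmulA M)) //; lia.
- by rewrite merge_insert_lt //; lia.
- by rewrite (merge_insert_eq (@qmulx1 M)).
- by rewrite (merge_insert_eqS (@qmul1x M)).
- by rewrite merge_insert_gt //; lia.
- by rewrite insert_insert //; lia.
Qed.

Lemma col_mul_merge j f g :
  col_mul (merge_at qmul j f) (merge_at qmul j g) =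
  merge_at qmul j (col_mul f g).
Proof.
apply/funext => l; rewrite /col_mul {1 3}/merge_at [RHS]/merge_at.
have pre n : (n <= j)%N ->
    prefix_prod (merge_at qmul j g) n = prefix_prod g n.
  move=> nj; rewrite /prefix_prod; apply: eq_bigr => r _.
  by rewrite /merge_at (leq_trans (ltn_ord r)).
case: ltngtP => lj; first by rewrite pre // ltnW.
  by rewrite prefix_merge.
rewrite lj pre // prefix_prodS qconjMl qconjMr -!qmulA; congr (_ * _).
by rewrite !qmulA -qmulC.
Qed.

Lemma col_mul_insert j f g :
  col_mul (insert_after 1 j f) (insert_after 1 j g) =
  insert_after 1 j (col_mul f g).
Proof.
apply/funext => l; rewrite /col_mul {1 3}/insert_after [RHS]/insert_after.
case: leqP => lj.
  congr ((_ ^ _) * _); rewrite /prefix_prod; apply: eq_bigr => r _.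
  by rewrite /insert_after ltnW // (leq_trans (ltn_ord r)).
case: eqP => [_|/eqP nl]; first by rewrite qconj1x qmulx1.
case: l lj nl => // l; rewrite ltnS eqSS => jl nl /=.
by rewrite prefix_insert // ltn_neqAle eq_sym nl.
Qed.

Let mergeE i (G : nat -> nat -> M) k : merge_at col_mul i G k =
  if (k < i)%N then G k
  else if k == i then col_mul (G i) (G i.+1) else G k.+1.
Proof. by []. Qed.

Let insertE i (G : nat -> nat -> M) k : insert_after (fun=> 1) i G k =
  if (k <= i)%N then G k else if k == i.+1 then fun=> 1 else G k.-1.
Proof. by []. Qed.

Lemma merge_cols_rows i j F :
  merge_at col_mul i (fun k => merge_at qmul j (F k)) =
  (fun k => merge_at qmul j (merge_at col_mul i F k)).
Proof.
apply/funext => k; rewrite !mergeE.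
by case: ifP => // _; case: ifP => // _; exact: col_mul_merge.
Qed.

Lemma merge_cols_insert_rows i j F :
  merge_at col_mul i (fun k => insert_after 1 j (F k)) =
  (fun k => insert_after 1 j (merge_at col_mul i F k)).
Proof.
apply/funext => k; rewrite !mergeE.
by case: ifP => // _; case: ifP => // _; exact: col_mul_insert.
Qed.

Lemma insert_cols_merge_rows i j F :
  insert_after (fun=> 1) i (fun k => merge_at qmul j (F k)) =
  (fun k => merge_at qmul j (insert_after (fun=> 1) i F k)).
Proof.
apply/funext => k; rewrite (insertE _ (fun k => merge_at qmul j (F k))).
rewrite (insertE i F k).
case: (k <= i)%N => //; case: (k == i.+1) => //; apply/funext => l; rewrite /merge_at.
by rewrite qmul1x !if_same.
Qed.

Lemma insert_cols_rows i j F :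
  insert_after (fun=> 1) i (fun k => insert_after 1 j (F k)) =
  (fun k => insert_after 1 j (insert_after (fun=> 1) i F k)).
Proof.
apply/funext => k; rewrite (insertE _ (fun k => insert_after 1 j (F k))).
rewrite (insertE i F k).
case: (k <= i)%N => //; case: (k == i.+1) => //; apply/funext => l; rewrite /insert_after.
by rewrite !if_same.
Qed.

Lemma arr_hface_vface p q i j (a : arr p.+1 q.+1) :
  (i <= p.+1)%N -> (j <= q.+1)%N ->
  arr_hface i (arr_vface j a) = arr_vface j (arr_hface i a).
Proof. by move=> ip jq; rewrite -(gridK a) !arrE merge_cols_rows. Qed.

Lemma arr_hface_vdeg p q i j (a : arr p.+1 q) :
  (i <= p.+1)%N -> (j <= q)%N ->
  arr_hface i (arr_vdeg j a) = arr_vdeg j (arr_hface i a).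
Proof. by move=> ip jq; rewrite -(gridK a) !arrE // merge_cols_insert_rows. Qed.

Lemma arr_hdeg_vface p q i j (a : arr p q.+1) :
  (i <= p)%N -> (j <= q.+1)%N ->
  arr_hdeg i (arr_vface j a) = arr_vface j (arr_hdeg i a).
Proof. by move=> ip jq; rewrite -(gridK a) !arrE // insert_cols_merge_rows. Qed.

Lemma arr_hdeg_vdeg p q i j (a : arr p q) :
  (i <= p)%N -> (j <= q)%N ->
  arr_hdeg i (arr_vdeg j a) = arr_vdeg j (arr_hdeg i a).
Proof. by move=> ip jq; rewrite -(gridK a) !arrE // insert_cols_rows. Qed.

Definition Arr : bisimplicialSet := BisimplicialSet arr_horizontal arr_vertical
  arr_hface_vface arr_hface_vdeg arr_hdeg_vface arr_hdeg_vdeg.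

End Arrays.

Section ArrayMaps.
Variable M : completePMQType.
Implicit Types (F G : nat -> nat -> M).

Definition total_prod p q (a : Arr M p q) : M :=
  \big[qmul/qone]_(i < p.+2) \big[qmul/qone]_(j < q.+2) a i j.

Lemma total_prod_array p q F : total_prod (array p.+2 q.+2 F) =
  prefix_prod (fun k => prefix_prod (F k) q.+2) p.+2.
Proof. by apply: eq_bigr => k _; apply: eq_bigr => l _; rewrite mxE. Qed.

Lemma total_prod_hface p q i (a : Arr M p.+1 q) : (i <= p.+1)%N ->
  total_prod (hface i a) = total_prod a.
Proof.
move=> ip; rewrite -[a]gridK [hface _ _]arr_hface_array !total_prod_array.
rewrite -[RHS](@prefix_merge _ i) ?ltnS //; congr prefix_prod; apply/funext => k.
by rewrite /merge_at; do 2 case: ifP => // _; rewrite prefix_col_mul.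
Qed.

Lemma total_prod_hdeg p q i (a : Arr M p q) : (i <= p)%N ->
  total_prod (hdeg i a) = total_prod a.
Proof.
move=> ip; rewrite -[a]gridK [hdeg _ _]arr_hdeg_array // !total_prod_array.
rewrite -[RHS](@prefix_insert _ i _ p.+2) ?ltnS 1?ltnW //; congr prefix_prod.
apply/funext => k.
by rewrite /insert_after; do 2 case: ifP => // _; rewrite prefix_prod1.
Qed.

Lemma total_prod_vface p q j (a : Arr M p q.+1) : (j <= q.+1)%N ->
  total_prod (vface j a) = total_prod a.
Proof.
move=> jq; rewrite -[a]gridK [vface _ _]arr_vface_array !total_prod_array.
by congr prefix_prod; apply/funext => k; rewrite prefix_merge // ltnS.
Qed.

Lemma total_prod_vdeg p q j (a : Arr M p q) : (j <= q)%N ->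
  total_prod (vdeg j a) = total_prod a.
Proof.
move=> jq; rewrite -[a]gridK [vdeg _ _]arr_vdeg_array // !total_prod_array.
by congr prefix_prod; apply/funext => k; rewrite prefix_insert // ltnS ltnW.
Qed.

Definition arr_conj (b : M) p q (a : Arr M p q) : Arr M p q :=
  map_mx (qconj^~ b) a.

Lemma arr_conj_array b p q F : arr_conj b (array p.+2 q.+2 F : Arr M p q) =
  array p.+2 q.+2 (fun k l => F k l ^ b).
Proof. by apply/matrixP => k l; rewrite !mxE. Qed.

Lemma prefix_prod_conj b (f : nat -> M) n :
  prefix_prod (fun l => f l ^ b) n = prefix_prod f n ^ b.
Proof.
elim: n => [|n IH]; first by rewrite !prefix_prod0 qconj1x.
by rewrite !prefix_prodS IH qconjMl.
Qed.

Lemma total_prod_conj b p q (a : Arr M p q) :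
  total_prod (arr_conj b a) = total_prod a ^ b.
Proof.
rewrite -[a]gridK arr_conj_array !total_prod_array -prefix_prod_conj.
by congr prefix_prod; apply/funext => k; rewrite prefix_prod_conj.
Qed.

Lemma arr_conj_bisimplicial b : bisimplicial_map (@arr_conj b).
Proof.
split=> p q i a ip; rewrite -[a]gridK.
- rewrite [hface _ _]arr_hface_array !arr_conj_array.
  rewrite [RHS]arr_hface_array; congr array; apply/funext => k.
  apply/funext => l; rewrite /merge_at; do 2 case: ifP => // _.
  by rewrite /col_mul qconjMl prefix_prod_conj -qconj_conj.
- rewrite [hdeg _ _]arr_hdeg_array // !arr_conj_array.
  rewrite [RHS]arr_hdeg_array //; congr array; apply/funext => k.
  apply/funext => l; rewrite /insert_after; do 2 case: ifP => // _.
  by rewrite qconj1x.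
- rewrite [vface _ _]arr_vface_array !arr_conj_array.
  rewrite [RHS]arr_vface_array; congr array; apply/funext => k.
  apply/funext => l; rewrite /merge_at; do 2 case: ifP => // _.
  by rewrite qconjMl.
- rewrite [vdeg _ _]arr_vdeg_array // !arr_conj_array.
  rewrite [RHS]arr_vdeg_array //; congr array; apply/funext => k.
  apply/funext => l; rewrite /insert_after; do 2 case: ifP => // _.
  by rewrite qconj1x.
Qed.

End ArrayMaps.

(* A disjoint union of spaces X(a) indexed by M is a space with a continuous
   map to M with the discrete topology, X(a) being the fibre over a. *)
Record crossedSpace (M : completePMQType) := CrossedSpace {
  crossed_sort :> topologicalType;
  grading : crossed_sort -> M;
  crossed_act : M -> crossed_sort -> crossed_sort;
  grading_continuous : continuous (grading : _ -> discrete_topology M);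
  crossed_act_continuous : forall b, continuous (crossed_act b);
  grading_act : forall b x, grading (crossed_act b x) = grading x ^ b;
  crossed_actM : forall b c x,
    crossed_act c (crossed_act b x) = crossed_act (b * c) x
}.

Definition crossed_map (M : completePMQType) (X Y : crossedSpace M)
    (f : X -> Y) : Prop :=
  [/\ continuous f, forall x, grading (f x) = grading x
    & forall b x, f (crossed_act b x) = crossed_act b (f x)].

Section DiscreteCrossed.
Variable M : completePMQType.
Let D := discrete_topology M.

Let discrete_continuous (f : D -> D) : continuous f.
Proof. by apply/continuousP => A _; exact: discrete_open. Qed.

Definition discrete_crossed : crossedSpace M :=
  @CrossedSpace M D id (fun b a => a ^ b)
    (@discrete_continuous id) (fun b => @discrete_continuous (qconj^~ b))
    (fun _ _ => erefl) (fun b c a => esym (qconjMr a b c)).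
End DiscreteCrossed.

Section Hurwitz.
Variables (R : realType) (Q : pmqType) (Qh : completion Q).

Definition admissible p q (a : Arr Qh p q) : Prop :=
  (forall (k : 'I_p.+2) (l : 'I_q.+2),
     k \in [:: ord0; ord_max] \/ l \in [:: ord0; ord_max] -> a k l = 1) /\
  (forall (k : 'I_p.+2) (l : 'I_q.+2), range (completion_map Qh) (a k l)).

Definition NAdm p q : set (Arr Qh p q) := [set a | ~ admissible a].

Definition hurwitz : set (realization R (Arr Qh)) :=
  ~` realization_sub NAdm.

Let wcell (y : cells R (Arr Qh)) : discrete_topology Qh :=
  total_prod (projT2 y).1.

Let wcell_glue y z : cell_glue y z -> wcell y = wcell z.
Proof.
case=> p q i a s t ip; [exact: total_prod_hface|exact: total_prod_hdeg|
  exact: total_prod_vface|exact: total_prod_vdeg].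
Qed.

Definition hurwitz_grading (z : hurwitz) : Qh :=
  descend (fun y : cells R (Arr Qh) => total_prod (projT2 y).1) (val z).

Lemma hurwitz_gradingE (z : hurwitz) p q (a : Arr Qh p q) s t :
  val z = point_of a s t -> hurwitz_grading z = total_prod a.
Proof. by rewrite /hurwitz_grading => ->; exact: descend_pi. Qed.

Lemma hurwitz_grading_continuous :
  continuous (hurwitz_grading : hurwitz -> discrete_topology Qh).
Proof.
have dc : continuous (descend wcell).
  apply: descend_continuous => //.
  by apply: cells_continuous => p q a st; exact: cst_continuous.
move=> z U nU.
exact: (@initial_continuous _ _ (val : hurwitz -> _) z _ (dc (val z) U nU)).
Qed.

Lemma admissible_conj b p q (a : Arr Qh p q) :
  admissible (arr_conj b a) <-> admissible a.
Proof.
split=> -[a1 aQ]; split=> k l.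
- by move=> /a1; rewrite mxE -[RHS](qconj1x b) => /qconj_inj.
- by have := aQ k l; rewrite mxE completion_map_conj.
- by move=> /a1; rewrite mxE => ->; rewrite qconj1x.
- by rewrite mxE completion_map_conj.
Qed.

Lemma hurwitz_conj b (z : hurwitz) :
  realization_map (@arr_conj Qh b) (val z) \in hurwitz.
Proof.
have [g gK Kg] := @qconj_bij Qh b.
pose G p q (a : Arr Qh p q) : Arr Qh p q := map_mx g a.
have GK p q : cancel (@arr_conj Qh b p q) (@G p q).
  by move=> a; apply/matrixP => k l; rewrite !mxE.
have KG p q : cancel (@G p q) (@arr_conj Qh b p q).
  by move=> a; apply/matrixP => k l; rewrite !mxE.
have GB := bisimplicial_map_inv (arr_conj_bisimplicial b) GK KG.
apply/mem_set => -[p [q [a [s [t [na E]]]]]]; apply: (set_valP z).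
exists p, q, (G _ _ a), s, t; split.
  by move=> ha; apply: na; rewrite -[a]KG; apply/admissible_conj.
rewrite -(realization_mapE GB) -E; elim/realization_ind: (val z) => p' q' x u v.
by rewrite !realization_mapE ?GK //; exact: arr_conj_bisimplicial.
Qed.

Definition hurwitz_act (b : Qh) (z : hurwitz) : hurwitz :=
  exist _ (realization_map (@arr_conj Qh b) (val z)) (hurwitz_conj b z).

Lemma hurwitz_act_continuous b : continuous (hurwitz_act b).
Proof.
have rc := @realization_map_continuous R _ _ _ (arr_conj_bisimplicial b).
apply: continuous_comp_initial => z U nU.
exact: (@initial_continuous _ _ (val : hurwitz -> _) z _ (rc (val z) U nU)).
Qed.

Lemma hurwitz_grading_act b z :
  hurwitz_grading (hurwitz_act b z) = hurwitz_grading z ^ b.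
Proof.
have [p [q [a [s [t zE]]]]] : exists p q (a : Arr Qh p q) s t, val z = point_of a s t.
  elim/realization_ind: (val z) => p q a s t.
  by exists p, q, a, s, t.
rewrite (hurwitz_gradingE zE) -total_prod_conj.
apply: hurwitz_gradingE; rewrite /= zE.
by rewrite realization_mapE //; exact: arr_conj_bisimplicial.
Qed.

Lemma hurwitz_actM b c z :
  hurwitz_act c (hurwitz_act b z) = hurwitz_act (b * c) z.
Proof.
apply: val_inj => /=; elim/realization_ind: (val z) => p q a s t.
rewrite !realization_mapE; try exact: arr_conj_bisimplicial.
by congr point_of; apply/matrixP => k l; rewrite !mxE qconjMr.
Qed.

Definition Hur : crossedSpace Qh := CrossedSpace hurwitz_grading_continuous
  hurwitz_act_continuous hurwitz_grading_act hurwitz_actM.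

Definition total_monodromy : Hur -> discrete_crossed Qh := hurwitz_grading.

End Hurwitz.

Section Components.

Definition components (T : topologicalType) : set (set T) :=
  range (connected_component [set: T]).
Arguments components : clear implicits.

(* For continuous f this sends the component of x to the component of f x. *)
Definition components_map (T U : topologicalType) (f : T -> U) :
    set T -> set U :=
  fun C => \bigcup_(x in C) connected_component [set: U] (f x).

End Components.
Arguments components : clear implicits.

(* Main.v *)
(* The completion is the monoid of words in Q modulo dropping 1, multiplying
   adjacent letters whose product is defined and replacing ab by b(a^b): these
   classes form a complete PMQ receiving Q, so two words with the same product
   in the completion are related by such moves.

   A point of |Arr| is a configuration of labelled points in the unit square:
   column i sits at abscissa s_0 + ... + s_(i-1), row j at ordinate
   t_0 + ... + t_(j-1), and the labels of columns or rows sharing a coordinate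
   are multiplied together.  The resulting function on the square does not
   depend on the cell used to represent the point, whence a point in the
   interior of an admissible cell lies in the Hurwitz space, and every point of
   the Hurwitz space is joined by a segment to the barycentre of an admissible
   cell.  Consequently the barycentre of an admissible face of an array is
   joined to that of the array.

   Any admissible array is an iterated face of one whose columns meet the two top rows at
   most once; merging these two rows reduces it eventually to a single row, that
   is to a word.  The moves of words are realised by merging columns, the move
   ab -> b(a^b) through an array with two rows in which a lies above b. *)
From HB Require Import structures.
From Stdlib Require Import Relation_Operators.
Require Import Defs.
From mathcomp Require Import all_boot all_order all_algebra generic_quotient.
From mathcomp Require Import all_classical all_reals all_analysis.
From mathcomp Require Import zify.
Set Implicit Arguments.
Unset Strict Implicit.
Unset Printing Implicit Defensive.
Import Order.TTheory GRing.Theory Num.Theory.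
Import numFieldNormedType.Exports.

Local Open Scope classical_set_scope.
Local Open Scope pmq_scope.

(** * Words and the presentation of the completion *)

Section Words.
Variable Q : pmqType.
Implicit Types (a b c : Q) (u v w : seq Q).

Inductive word_step : seq Q -> seq Q -> Prop :=
| step_unit u v : word_step (u ++ 1 :: v) (u ++ v)
| step_mul u v a b c : qpmul a b = Some c ->
    word_step (u ++ a :: b :: v) (u ++ c :: v)
| step_conj u v a b : word_step (u ++ a :: b :: v) (u ++ b :: a ^ b :: v).

Definition word_eq := clos_refl_sym_trans (seq Q) word_step.

Lemma word_eq_homo (T : Type) (f : seq Q -> T) :
  (forall u v, word_step u v -> f u = f v) ->
  forall u v, word_eq u v -> f u = f v.
Proof.
move=> fE u v; elim=> {u v} [u v /fE||u v _ <-|u v w _ -> _ ->] //.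
Qed.

Lemma word_eq_map (f : seq Q -> seq Q) :
  (forall u v, word_step u v -> word_eq (f u) (f v)) ->
  forall u v, word_eq u v -> word_eq (f u) (f v).
Proof.
move=> fE u v; elim=> {u v} [u v /fE|u|u v _|u v w _ uv _] //.
- exact: rst_refl.
- exact: rst_sym.
- exact: rst_trans.
Qed.

Lemma word_eq_catl u v w : word_eq u v -> word_eq (w ++ u) (w ++ v).
Proof.
apply: word_eq_map => {}u {}v.
case=> [u' v'|u' v' a b c abc|u' v' a b]; rewrite !catA; apply: rst_step.
- exact: step_unit.
- exact: step_mul.
- exact: step_conj.
Qed.

Lemma word_eq_catr u v w : word_eq u v -> word_eq (u ++ w) (v ++ w).
Proof.
apply: (@word_eq_map (cat^~ w)) => {}u {}v.
case=> [u' v'|u' v' a b c abc|u' v' a b]; rewrite -!catA; apply: rst_step.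
- exact: step_unit.
- exact: step_mul.
- exact: step_conj.
Qed.

Lemma word_eq_cat u u' v v' :
  word_eq u u' -> word_eq v v' -> word_eq (u ++ v) (u' ++ v').
Proof.
by move=> uu' vv'; apply: rst_trans (word_eq_catr _ uu') (word_eq_catl _ vv').
Qed.

(** Conjugation of a letter by a word can be carried out inside [Q]; on classes it becomes
    conjugation by the class of v. *)
Definition act a v := foldl qconj a v.
Arguments act : simpl never.

Definition word_conj u v := map (act^~ v) u.

Lemma act_cat a u v : act a (u ++ v) = act (act a u) v.
Proof. exact: foldl_cat. Qed.

Lemma act1 v : act 1 v = 1.
Proof. by elim: v => //= a v IH; rewrite /act /= qconj1x. Qed.

Lemma act_conj a b v : act (a ^ b) v = act a v ^ act b v.
Proof.
elim: v a b => //= c v IH a b.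
by rewrite /act /= qconj_conj -/(act _ v) IH.
Qed.

Lemma act_pmul a b v :
  omap (act^~ v) (qpmul a b) = qpmul (act a v) (act b v).
Proof.
elim: v a b => [|c v IH] a b; first by case: qpmul.
by rewrite /act /= -/(act _ v) -IH -qconj_pmul; case: qpmul.
Qed.

Lemma act_bij v : bijective (act^~ v).
Proof.
elim: v => [|c v IH]; first by exists id.
exact: (bij_comp IH (qconj_bij c)).
Qed.

(** The three moves are harmless by a^1 = a, by a^(bc) = (a^b)^c and by self-distributivity. Hence
    [word_conj] depends on its second argument only up to equivalence. *)
Lemma act_eq a u v : word_eq u v -> act a u = act a v.
Proof.
apply: (@word_eq_homo _ (act a)) => {}u {}v.
case=> {}u {}v => [|b c d bcd|b c]; rewrite !act_cat /act /=.
- by rewrite qconjx1.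
- by rewrite (qconjM _ _ _ _ bcd).
- by rewrite qconj_conj.
Qed.

Lemma word_eq_pmq_map (f : Q -> Q) u v :
  pmq_map f -> word_eq u v -> word_eq (map f u) (map f v).
Proof.
move=> [f1 fJ fM]; apply: (@word_eq_map (map f)) => {}u {}v.
case=> {}u {}v => [|b c d bcd|b c]; rewrite !map_cat /=; apply: rst_step.
- by rewrite f1; exact: step_unit.
- exact/step_mul/fM.
- by rewrite fJ; exact: step_conj.
Qed.

Lemma act_pmq_map v : pmq_map (act^~ v).
Proof.
split=> [|a b|a b c abc]; first exact: act1.
  exact: act_conj.
by rewrite -act_pmul abc.
Qed.

(** The inverse preserves defined products because conjugation also reflects definedness. It yields
    the inverse of conjugation by v on classes. *)
Lemma act_inv v : exists2 f : Q -> Q,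
  pmq_map f & cancel (act^~ v) f /\ cancel f (act^~ v).
Proof.
have [f fK Kf] := act_bij v; exists f => //.
have [a1 aJ _] := act_pmq_map v.
have inj := can_inj fK.
split=> [|a b|a b c abc].
- by apply: inj; rewrite /= Kf a1.
- by apply: inj; rewrite /= aJ !Kf.
- have := act_pmul (f a) (f b) v; rewrite !Kf abc.
  by case: qpmul => //= d [<-]; rewrite fK.
Qed.

Lemma word_conj_cat u v w : word_conj w (u ++ v) = word_conj (word_conj w u) v.
Proof. by rewrite /word_conj -map_comp; apply: eq_map => a; exact: act_cat. Qed.

Lemma act_word_conj a u v : act (act a u) v = act (act a v) (word_conj u v).
Proof.
elim: u a => [|b u IH] a //.
rewrite [act a (b :: u)]/act /= -/(act _ u) IH act_conj.
by [].
Qed.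

Lemma word_conj_conj u v w :
  word_conj (word_conj u v) w = word_conj (word_conj u w) (word_conj v w).
Proof.
by rewrite /word_conj -!map_comp; apply: eq_map => a; exact: act_word_conj.
Qed.

Lemma word_conjl u u' v : word_eq u u' -> word_eq (word_conj u v) (word_conj u' v).
Proof. exact/word_eq_pmq_map/act_pmq_map. Qed.

Lemma word_conjr u v v' : word_eq v v' -> word_conj u v = word_conj u v'.
Proof. by move=> vv'; apply: eq_map => a; exact: act_eq. Qed.

Lemma word_eq_swap1 a v : word_eq (a :: v) (v ++ [:: act a v]).
Proof.
elim: v a => [|b v IH] a; first exact: rst_refl.
apply: (rst_trans _ _ _ (b :: a ^ b :: v)).
  exact/rst_step/(step_conj [::]).
exact: (word_eq_catl [:: b] (IH _)).
Qed.

Lemma word_eq_swap u v : word_eq (u ++ v) (v ++ word_conj u v).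
Proof.
elim: u => [|a u IH]; first by rewrite cats0; exact: rst_refl.
apply: rst_trans (word_eq_catl [:: a] IH) _.
rewrite -[[:: a] ++ _]/((a :: v) ++ word_conj u v).
by rewrite [word_conj (a :: u) v]/= -cat_rcons -cats1; apply/word_eq_catr/word_eq_swap1.
Qed.

(* Uses au ~ u a^u ~ a^u u^(a^u), the latter word being (au)^(au) up to the
   induction hypothesis u^u ~ u.  The relation uu ~ u u^u is not enough, as the
   completion need not be cancellative. *)
Lemma word_conj_self u : word_eq (word_conj u u) u.
Proof.
elim: u => [|a u IH]; first exact: rst_refl.
have aE : act a (a :: u) = act a u by rewrite /act /= qconjxx.
rewrite /= aE (word_conj_cat [:: a] u u) word_conj_conj.
rewrite [word_conj [:: a] u]/=.
apply: rst_trans; first exact: (word_eq_catl [:: act a u] (word_conjl _ IH)).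
apply: rst_trans; first exact/rst_sym/(word_eq_swap u).
exact/rst_sym/word_eq_swap1.
Qed.

(** * Partial evaluation of words in [Q] *)

Fixpoint word_eval u : option Q :=
  if u is a :: v then obind (qpmul a) (word_eval v) else Some 1.

(** Adjoining an absorbing element [None] turns the partial monoid into an honest one: its axiom on
    bracketings becomes associativity. *)
Definition opmul (x y : option Q) : option Q :=
  obind (fun a => obind (qpmul a) y) x.

Lemma opmulA : associative opmul.
Proof.
case=> [a|] // [b|] //= [c|]; last by rewrite /opmul /=; case: qpmul.
rewrite /opmul /=.
have h d := qpmulA a b c d.
case E : (obind _ (qpmul b c)) => [d|].
  move: E; case bc : qpmul => [x|] //= ax.
  have /h[y -> /= ->] // : exists2 x, qpmul b c = Some x & qpmul a x = Some d.
  by exists x.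
case E' : (obind _ (qpmul a b)) => [d|] //.
move: E'; case ab : qpmul => [x|] //= xc.
have /h[y bc ay] : exists2 x, qpmul a b = Some x & qpmul x c = Some d.
  by exists x.
by move: E; rewrite bc /= ay.
Qed.

Lemma word_eval_cat u v : word_eval (u ++ v) = opmul (word_eval u) (word_eval v).
Proof.
elim: u => [|a u IH] /=.
  by rewrite /opmul /=; case: word_eval => //= a; rewrite qpmul1x.
have opE x : obind (qpmul a) x = opmul (Some a) x by [].
by rewrite !opE IH opmulA.
Qed.

(** This invariant detects [Q] inside the completion: a word equivalent to a single letter evaluates
    to that letter, and then so do its prefixes and suffixes to letters of their own. *)
Lemma word_eval_eq u v : word_eq u v -> word_eval u = word_eval v.
Proof.
apply: word_eq_homo => {}u {}v.
case=> {}u {}v => [|a b c abc|a b]; rewrite !word_eval_cat; congr opmul => /=.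
- by case: word_eval => //= a; rewrite qpmul1x.
- have := opmulA (Some a) (Some b) (word_eval v); rewrite /opmul /= => ->.
  by rewrite abc.
- have := opmulA (Some a) (Some b) (word_eval v); rewrite /opmul /= => ->.
  rewrite qpmulC; have := opmulA (Some b) (Some (a ^ b)) (word_eval v).
  by rewrite /opmul /= => ->.
Qed.

Lemma word_eval_self u a : word_eval u = Some a -> word_eq u [:: a].
Proof.
elim: u a => [a [<-]|a u IH b] /=; first exact/rst_sym/rst_step/(step_unit [::] [::]).
case E : (word_eval u) => [c|] //= abc.
apply: rst_trans; first exact: (word_eq_catl [:: a] (IH _ E)).
exact/rst_step/(step_mul [::] [::]).
Qed.

(** * The complete PMQ of classes of words *)

Definition word_rel : rel (seq Q) := fun u v => `[< word_eq u v >].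

Lemma word_rel_equiv : equiv_class_of word_rel.
Proof.
split=> [u|u v|v u w].
- exact/asboolP/rst_refl.
- by apply/asboolP/asboolP; exact: rst_sym.
- by move=> /asboolP uv /asboolP vw; apply/asboolP; exact: rst_trans vw.
Qed.

Canonical word_equiv := EquivRelPack word_rel_equiv.

Definition word_class : Type := {eq_quot word_equiv}%qT.
HB.instance Definition _ := Choice.on word_class.
HB.instance Definition _ := Quotient.on word_class.

Definition class u : word_class := (\pi_(word_class) u)%qT.

Lemma class_eq u v : word_eq u v -> class u = class v.
Proof. by move=> uv; apply/eqquotP/asboolP. Qed.

Lemma class_inj u v : class u = class v -> word_eq u v.
Proof. by move/eqquotP/asboolP. Qed.

Lemma class_ind (P : word_class -> Prop) : (forall u, P (class u)) -> forall x, P x.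
Proof. by move=> h x; rewrite -[x]reprK; exact: h. Qed.

Lemma repr_class u : word_eq (repr (class u)) u.
Proof. by apply: class_inj; rewrite /class reprK. Qed.

Definition class_mul (x y : word_class) : word_class := class (repr x ++ repr y).
Definition class_conj (x y : word_class) : word_class :=
  class (word_conj (repr x) (repr y)).

Lemma class_mulE u v : class_mul (class u) (class v) = class (u ++ v).
Proof. by apply/class_eq/word_eq_cat; exact: repr_class. Qed.

Lemma class_conjE u v : class_conj (class u) (class v) = class (word_conj u v).
Proof.
rewrite /class_conj (word_conjr _ (repr_class v)).
exact/class_eq/word_conjl/repr_class.
Qed.

HB.instance Definition _ := hasUnit1.Build word_class (class [::]).

Let class_conj_bij y : bijective (class_conj^~ y).
Proof.
elim/class_ind: y => v; have [f fm [fK Kf]] := act_inv v.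
have fE u : class (map f (repr (class u))) = class (map f u).
  exact/class_eq/word_eq_pmq_map/repr_class.
exists (fun x => class (map f (repr x))); elim/class_ind => u.
  by rewrite class_conjE fE /word_conj mapK.
by rewrite fE class_conjE /word_conj mapK.
Qed.

Let class_conj1x y : class_conj (class [::]) y = class [::].
Proof. by elim/class_ind: y => v; rewrite class_conjE. Qed.

Let class_conjx1 x : class_conj x (class [::]) = x.
Proof. by elim/class_ind: x => u; rewrite class_conjE /word_conj map_id. Qed.

Let class_conjxx x : class_conj x x = x.
Proof. by elim/class_ind: x => u; rewrite class_conjE; exact/class_eq/word_conj_self. Qed.

Let class_conj_conj x y z :
  class_conj (class_conj x y) z = class_conj (class_conj x z) (class_conj y z).
Proof.
elim/class_ind: x => u; elim/class_ind: y => v; elim/class_ind: z => w.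
by rewrite !class_conjE word_conj_conj.
Qed.

HB.instance Definition _ := isQuandle.Build word_class
  class_conj_bij class_conj1x class_conjx1 class_conjxx class_conj_conj.

Lemma class_qconjE u v : class u ^ class v = class (word_conj u v).
Proof. exact: class_conjE. Qed.

Let class_mul1x x : Some (class_mul (class [::]) x) = Some x.
Proof. by elim/class_ind: x => u; rewrite class_mulE. Qed.

Let class_mulx1 x : Some (class_mul x (class [::])) = Some x.
Proof. by elim/class_ind: x => u; rewrite class_mulE cats0. Qed.

Let class_mulA x y z t :
  (exists2 xy, Some (class_mul x y) = Some xy & Some (class_mul xy z) = Some t) <->
  (exists2 yz, Some (class_mul y z) = Some yz & Some (class_mul x yz) = Some t).
Proof.
have E : class_mul x (class_mul y z) = class_mul (class_mul x y) z.
  elim/class_ind: x => u; elim/class_ind: y => v; elim/class_ind: z => w.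
  by rewrite !class_mulE catA.
by split=> -[r [<-] [<-]]; eexists; try reflexivity; rewrite E.
Qed.

HB.instance Definition _ := @isPartialMonoid.Build word_class
  (fun x y => Some (class_mul x y)) class_mul1x class_mulx1 class_mulA.

Let class_mulC (x y : word_class) : qpmul x y = qpmul y (qconj x y).
Proof.
congr Some; elim/class_ind: x => u; elim/class_ind: y => v.
by rewrite class_qconjE !class_mulE; exact/class_eq/word_eq_swap.
Qed.

Let class_conjM (x y z yz : word_class) :
  qpmul y z = Some yz -> qconj x yz = qconj (qconj x y) z.
Proof.
move=> [<-]; elim/class_ind: x => u; elim/class_ind: y => v; elim/class_ind: z => w.
by rewrite class_mulE !class_qconjE word_conj_cat.
Qed.

Let class_conj_mul (x y z : word_class) :
  omap (qconj^~ z) (qpmul x y) = qpmul (qconj x z) (qconj y z).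
Proof.
congr Some; elim/class_ind: x => u; elim/class_ind: y => v; elim/class_ind: z => w.
by rewrite /= class_mulE !class_qconjE class_mulE /word_conj map_cat.
Qed.

HB.instance Definition _ := Quandle_PartialMonoid_isPMQ.Build word_class
  class_mulC class_conjM class_conj_mul.

Let class_mul_total (x y : word_class) : qpmul x y = Some (class_mul x y).
Proof. by []. Qed.

HB.instance Definition _ := isCompletePMQ.Build word_class class_mul_total.

Lemma class_qmulE u v : class u * class v = class (u ++ v).
Proof. exact: class_mulE. Qed.

Lemma letter_pmq_map : pmq_map (fun a => class [:: a]).
Proof.
split=> [|a b|a b c abc].
- exact/class_eq/rst_step/(step_unit [::] [::]).
- by rewrite class_qconjE.
- rewrite qpmulE; congr Some; rewrite class_qmulE.
  exact/class_eq/rst_step/(step_mul [::] [::]).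
Qed.

End Words.

(** * Words represent the completion *)

Section CompletionPresentation.
Variables (Q : pmqType) (Qh : completion Q).
Local Notation cm := (completion_map Qh).
Implicit Types (u v : seq Q) (x y : Qh).

Definition word_prod u : Qh := \big[qmul/1]_(a <- u) cm a.

(** Initiality gives a map g from the completion to classes of words; it sends the product of u to
    the class of u. *)
Lemma word_prod_eq u v : word_prod u = word_prod v -> word_eq u v.
Proof.
have [g [[[g1 gJ gM] gE] _]] := completion_initial Qh (letter_pmq_map Q).
have gP w : g (word_prod w) = class w.
  rewrite /word_prod; elim: w => [|a w IH]; first by rewrite big_nil g1.
  have /gM : qpmul (cm a) (\big[qmul/1]_(b <- w) cm b) =
    Some (\big[qmul/1]_(b <- a :: w) cm b) by rewrite qpmulE big_cons.
  rewrite IH qpmulE => -[<-].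
  have -> : g (cm a) = class [:: a] by rewrite -[LHS]/((g \o cm) a) gE.
  by rewrite class_qmulE.
by move/(congr1 g); rewrite !gP => /class_inj.
Qed.

Lemma word_prod_cat u v : word_prod (u ++ v) = word_prod u * word_prod v.
Proof. by rewrite /word_prod big_cat. Qed.

(** The general f serves both for a conjugation and for its inverse. *)
Lemma word_prod_morph (f : Qh -> Qh) u :
  f 1 = 1 -> {morph f : x y / x * y} -> (forall a, range cm (f (cm a))) ->
  exists v, word_prod v = f (word_prod u).
Proof.
move=> f1 fM fr; rewrite /word_prod; elim: u => [|a u [v vE]].
  by exists [::]; rewrite !big_nil.
have [b _ bE] := fr a.
by exists (b :: v); rewrite !big_cons bE vE fM.
Qed.

Lemma word_prod_surj x : exists u, word_prod u = x.
Proof.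
pose S := [set x | exists u, word_prod u = x].
suff : S x by [].
apply: (@completion_ind _ _ S) => [|a]; last first.
  by exists [:: a]; rewrite /word_prod big_seq1.
split=> [|_ _ [u <-] [v <-]|_ y [u <-] _|x' y _ [u uE]].
- by exists [::]; rewrite /word_prod big_nil.
- by exists (u ++ v); exact: word_prod_cat.
- apply: (@word_prod_morph (qconj^~ y)) => [|z t|a]; first exact: qconj1x.
    exact: qconjMl.
  exact/completion_map_conj/imageT.
- have [h hK Kh] := @qconj_bij Qh y.
  rewrite -(hK x') -uE; apply: word_prod_morph => [|z t|a].
  + by have := hK 1; rewrite /= qconj1x.
  + by rewrite -{1}(Kh z) -{1}(Kh t) -qconjMl hK.
  + by apply/(completion_map_conj _ y); rewrite Kh; exact: imageT.
Qed.

Lemma eq_word_prod u v : word_eq u v -> word_prod u = word_prod v.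
Proof.
have [cm1 cmJ cmM] := completion_map_pmq Qh.
apply: word_eq_homo => {}u {}v.
have consE a w : word_prod (a :: w) = cm a * word_prod w.
  by rewrite /word_prod big_cons.
case=> {}u {}v => [|a b c abc|a b]; rewrite !word_prod_cat !consE; congr (_ * _).
- by rewrite cm1 qmul1x.
- by have := cmM _ _ _ abc; rewrite qpmulE qmulA => -[->].
- by rewrite cmJ !qmulA -qmulC.
Qed.

Lemma word_prod_eval u a : word_eval u = Some a -> word_prod u = cm a.
Proof. by move=> /word_eval_self/eq_word_prod ->; rewrite /word_prod big_seq1. Qed.

(** For words u and v with products x and y, the word u ++ v is equivalent to the letter a and so
    evaluates to a; then u and v evaluate separately to letters. *)
Lemma mul_in_range x y a : x * y = cm a ->
  exists b c, [/\ x = cm b, y = cm c & qpmul b c = Some a].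
Proof.
have [u <-] := word_prod_surj x; have [v <-] := word_prod_surj y.
rewrite -word_prod_cat -(_ : word_prod [:: a] = cm a); last first.
  by rewrite /word_prod big_seq1.
move=> /word_prod_eq/word_eval_eq; rewrite word_eval_cat /= qpmulx1 /opmul.
case vE : (word_eval v) => [b|]; case uE : (word_eval u) => [c|] //= bc.
by exists c, b; split=> //; exact: word_prod_eval.
Qed.

Lemma completion_range_mul x y : range cm (x * y) -> range cm x /\ range cm y.
Proof.
move=> [a _ /esym/mul_in_range[b [c [-> -> _]]]].
by split; exact: imageT.
Qed.

(** Augmentation enters here: the factors of 1 lie in [Q], and there an element other than 1 cannot
    divide 1. *)
Lemma mul_eq1 x y : augmented Q -> x * y = 1 -> x = 1 /\ y = 1.
Proof.
have [cm1 _ _] := completion_map_pmq Qh.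
move=> [_ _ idl idr]; rewrite -cm1 => /mul_in_range[b [c [-> -> bc]]].
have b1 : b = 1 by apply: contrapT => /idl/(_ bc).
by split; congr cm => //; apply: contrapT => /idr/(_ bc).
Qed.

End CompletionPresentation.

(** * Labels of configurations *)

Section LevelProduct.
Variables (K : eqType) (T : Type) (e : T) (op : Monoid.law e).
Implicit Types (h : nat -> K) (F : nat -> T).

(** The joint label of columns or rows at coinciding positions: h gives the positions and x is the
    one looked at. *)
Definition level_prod n h x F : T :=
  \big[op/e]_(m < n) (if h m == x then F m else e).

Lemma big_merge_at n i F : (i < n)%N ->
  \big[op/e]_(m < n) merge_at op i F m = \big[op/e]_(m < n.+1) F m.
Proof.
elim: n => // n IH; rewrite ltnS leq_eqVlt big_ord_recr => /predU1P[->|ni] /=.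
  rewrite !big_ord_recr /= -Monoid.mulmA /merge_at ltnn eqxx; congr (op _ _).
  by apply: eq_bigr => m _; rewrite ltn_ord.
rewrite IH // [RHS]big_ord_recr; congr (op _ _).
by rewrite /merge_at ltnNge ltnW //= gtn_eqF.
Qed.

Lemma big_insert_after n i F : (i < n)%N ->
  \big[op/e]_(m < n.+1) insert_after e i F m = \big[op/e]_(m < n) F m.
Proof.
move=> ilt; rewrite -(big_merge_at (insert_after e i F) ilt).
by rewrite (merge_insert_eq (Monoid.mulm1 op)).
Qed.

(** [unbump i] puts the factors i and i+1 on the same level, so they are kept or erased together. *)
Lemma level_prod_merge n i h x F : (i < n)%N ->
  level_prod n h x (merge_at op i F) = level_prod n.+1 (h \o unbump i) x F.
Proof.
move=> ilt; pose G m := if (h \o unbump i) m == x then F m else e.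
rewrite /level_prod -(big_merge_at G ilt); apply: eq_bigr => m _; rewrite /G.
rewrite /merge_at /= /unbump; case: (ltngtP m i) => mi.
- by rewrite subn0.
- by rewrite ltnS ltnW // subn1.

- by rewrite mi ltnn ltnSn subn0 subn1; case: ifP; rewrite ?Monoid.mulm1.
Qed.

Lemma level_prod_insert n i h x F : (i < n)%N ->
  level_prod n.+1 h x (insert_after e i F) = level_prod n (h \o bump i.+1) x F.
Proof.
move=> ilt; pose G m := if (h \o bump i.+1) m == x then F m else e.
rewrite /level_prod -(big_insert_after G ilt).
apply: eq_bigr => m _; rewrite /G /insert_after /= /bump.
case: (leqP m i) => mi; first by rewrite add0n.
case: (eqVneq (m : nat) i.+1) => mi1; first by rewrite if_same.
by have -> : ((i.+1 <= m.-1) + m.-1 = m)%N by lia.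
Qed.

Lemma level_prod_injective n h x F :
  (forall i j, (i < j < n)%N -> h i <> h j) ->
  level_prod n h x F = e \/
  exists i, [/\ (i < n)%N, h i = x & level_prod n h x F = F i].
Proof.
rewrite /level_prod; elim: n => [|n IH] hI; first by left; rewrite big_ord0.
rewrite big_ord_recr /=; case: eqP => [nx|_]; last first.
  rewrite Monoid.mulm1; case: IH => [i j ij|->|[i [ilt ix ->]]].
  - by apply: hI; lia.
  - by left.
  - by right; exists i; split=> //; lia.
right; exists n; split=> //; rewrite big1 ?Monoid.mul1m // => m _.
by case: eqP => // mx; case: (hI m n); rewrite ?mx ?nx //= ltn_ord ltnSn.
Qed.

End LevelProduct.

(** * Positions given by barycentric coordinates *)

Section Positions.
Variable R : realType.
Local Open Scope ring_scope.

Definition pos p (s : simplex R p) (k : nat) : R :=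
  \sum_(j < p.+1 | (j < k)%N) val s ord0 j.

Lemma pos_map m n (phi : 'I_m.+1 -> 'I_n.+1) (s : simplex R m) k :
  pos (simplex_map phi s) k = \sum_(j < m.+1 | (phi j < k)%N) val s ord0 j.
Proof.
rewrite /pos /simplex_map /pushforward /=.
under eq_bigr do rewrite mxE.
rewrite [RHS](partition_big phi (fun j : 'I_n.+1 => (j < k)%N)) //=.
apply: eq_bigr => j jk; apply: eq_bigl => i.
by apply/idP/andP => [/eqP ->|[]].
Qed.

(** The coface inserts a zero coordinate at place i, so the positions i and i+1 coincide. *)
Lemma pos_coface p i (s : simplex R p) : (i <= p.+1)%N ->
  pos (coface i s) = pos s \o unbump i.
Proof.
move=> ip; apply/funext => k; rewrite /coface pos_map; apply: eq_bigl => j.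
by rewrite /bump inordK /= /unbump; have := ltn_ord j; lia.
Qed.

(** Adding the coordinates i and i+1 forgets the position i+1 between them. *)
Lemma pos_codeg p i (s : simplex R p.+1) : (i <= p)%N ->
  pos (codeg i s) = pos s \o bump i.+1.
Proof.
move=> ip; apply/funext => k; rewrite /codeg pos_map; apply: eq_bigl => j.
by rewrite /unbump inordK /= /bump; have := ltn_ord j; lia.
Qed.

Lemma pos0 p (s : simplex R p) : pos s 0 = 0.
Proof. by rewrite /pos big_pred0. Qed.

Lemma pos_last p (s : simplex R p) : pos s p.+1 = 1.
Proof.
have [_ <-] := set_valP s; apply: eq_bigl => j; exact: ltn_ord.
Qed.

Lemma pos_lt p (s : simplex R p) k l : (forall j, 0 < val s ord0 j) ->
  (k < l <= p.+1)%N -> pos s k < pos s l.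
Proof.
move=> s0 /andP[kl lp]; have kp : (k < p.+1)%N by lia.
rewrite /pos [ltRHS](bigID (fun j : 'I_p.+1 => (j < k)%N)) /=.
rewrite [X in _ < X + _](eq_bigl (fun j : 'I_p.+1 => (j < k)%N)); last first.
  by move=> j /=; lia.
rewrite ltrDl (bigD1 (Ordinal kp)) /=; last by lia.
apply: ltr_pwDl; first exact: s0.
by apply: sumr_ge0 => j _; exact: ltW.
Qed.

End Positions.

HB.instance Definition _ (M : completePMQType) :=
  Monoid.isLaw.Build (nat -> M) (fun=> 1) (@col_mul M)
    (@col_mulA M) (@col_mul1l M) (@col_mul1r M).

(** * Labels of arrays under faces and degeneracies *)

Section Labels.
Variable M : completePMQType.
Implicit Types (F : nat -> nat -> M).

(** Outside the array [grid] falls back on index 0; padding by 1 instead makes faces and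
    degeneracies agree with [merge_at] and [insert_after] at all indices. *)
Definition extend p q (a : Arr M p q) : nat -> nat -> M := fun k l =>
  if (k < p.+2)%N && (l < q.+2)%N then a (inord k) (inord l) else 1.

Lemma array_extend p q (a : Arr M p q) : array p.+2 q.+2 (extend a) = a.
Proof.
rewrite -[RHS]gridK; apply: array_eq => k l kp lq.
by rewrite /extend kp lq.
Qed.

Lemma extend_array p q F :
  (forall k l, (p.+2 <= k)%N || (q.+2 <= l)%N -> F k l = 1) ->
  extend (array p.+2 q.+2 F : Arr M p q) = F.
Proof.
move=> F1; apply/funext => k; apply/funext => l; rewrite /extend.
case: ifP => [/andP[kp lq]|kl]; first by rewrite mxE !inordK.
by rewrite F1 //; lia.
Qed.

Lemma extend_out p q (a : Arr M p q) k l :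
  (p.+2 <= k)%N || (q.+2 <= l)%N -> extend a k l = 1.
Proof. by rewrite /extend; case: ifP => //; lia. Qed.

Lemma extend_hface p q i (a : Arr M p.+1 q) : (i <= p.+1)%N ->
  extend (hface i a) = merge_at (@col_mul M) i (extend a).
Proof.
move=> ip; rewrite -{1}[a]array_extend [hface _ _]arr_hface_array extend_array //.
move=> k l kl; rewrite /merge_at; case: ifP => [ki|_].
  by apply: extend_out; lia.
case: eqP => [ki|_]; last by apply: extend_out; lia.
rewrite /col_mul !(@extend_out _ _ a _ l); try lia.
by rewrite qconj1x qmulx1.
Qed.

Lemma extend_hdeg p q i (a : Arr M p q) : (i <= p)%N ->
  extend (hdeg i a) = insert_after (fun=> 1) i (extend a).
Proof.
move=> ip; rewrite -{1}[a]array_extend [hdeg _ _]arr_hdeg_array // extend_array //.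
move=> k l kl; rewrite /insert_after; case: ifP => [ki|_].
  by apply: extend_out; lia.
by case: eqP => // ki; apply: extend_out; lia.
Qed.

Lemma extend_vface p q j (a : Arr M p q.+1) : (j <= q.+1)%N ->
  extend (vface j a) = fun k => merge_at qmul j (extend a k).
Proof.
move=> jq; rewrite -{1}[a]array_extend [vface _ _]arr_vface_array extend_array //.
move=> k l kl; rewrite /merge_at; case: ifP => [ki|_].
  by apply: extend_out; lia.
case: eqP => [ki|_]; last by apply: extend_out; lia.
by rewrite !extend_out ?qmulx1 //; lia.
Qed.

Lemma extend_vdeg p q j (a : Arr M p q) : (j <= q)%N ->
  extend (vdeg j a) = fun k => insert_after 1 j (extend a k).
Proof.
move=> jq; rewrite -{1}[a]array_extend [vdeg _ _]arr_vdeg_array // extend_array //.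
move=> k l kl; rewrite /insert_after; case: ifP => [ki|_].
  by apply: extend_out; lia.
by case: eqP => // ki; apply: extend_out; lia.
Qed.

Variable K : eqType.

(* With h and k the positions of columns and rows, this is the label of the
   point (x, y); it is 1 off the grid. *)
Definition label p q (a : Arr M p q) (h k : nat -> K) (x y : K) : M :=
  level_prod qmul q.+2 k y (level_prod (@col_mul M) p.+2 h x (extend a)).

Lemma label_hface p q i (a : Arr M p.+1 q) h k : (i <= p.+1)%N ->
  label (hface i a) h k = label a (h \o unbump i) k.
Proof.
move=> ip; apply/funext => x; apply/funext => y.
by rewrite /label extend_hface // level_prod_merge.
Qed.

Lemma label_hdeg p q i (a : Arr M p q) h k : (i <= p)%N ->
  label (hdeg i a) h k = label a (h \o bump i.+1) k.
Proof.
move=> ip; apply/funext => x; apply/funext => y.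
by rewrite /label extend_hdeg // level_prod_insert //; lia.
Qed.

(** Meant for the row operations, which are endomorphisms of the monoid of columns. *)
Lemma level_prod_morph (f : (nat -> M) -> (nat -> M)) n (h : nat -> K) x F :
  f (fun=> 1) = (fun=> 1) -> {morph f : u v / col_mul u v} ->
  level_prod (@col_mul M) n h x (fun k => f (F k)) =
  f (level_prod (@col_mul M) n h x F).
Proof.
move=> f1 fM; rewrite /level_prod (big_morph f fM f1).
by apply: eq_bigr => m _; case: ifP.
Qed.

Lemma label_vface p q j (a : Arr M p q.+1) h k : (j <= q.+1)%N ->
  label (vface j a) h k = label a h (k \o unbump j).
Proof.
move=> jq; apply/funext => x; apply/funext => y.
rewrite /label extend_vface // (level_prod_morph (f := merge_at qmul j)).
- by rewrite level_prod_merge.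
- by apply/funext => l; rewrite /merge_at qmulx1 !if_same.
- by move=> f g; rewrite col_mul_merge.
Qed.

Lemma label_vdeg p q j (a : Arr M p q) h k : (j <= q)%N ->
  label (vdeg j a) h k = label a h (k \o bump j.+1).
Proof.
move=> jq; apply/funext => x; apply/funext => y.
rewrite /label extend_vdeg // (level_prod_morph (f := insert_after 1 j)).
- by rewrite level_prod_insert //; lia.
- by apply/funext => l; rewrite /insert_after !if_same.
- by move=> f g; rewrite col_mul_insert.
Qed.

Lemma label_injective p q (a : Arr M p q) h k x y :
  (forall i j, (i < j < p.+2)%N -> h i <> h j) ->
  (forall i j, (i < j < q.+2)%N -> k i <> k j) ->
  label a h k x y = 1 \/ exists i j, [/\ (i < p.+2)%N, (j < q.+2)%N,
    h i = x, k j = y & label a h k x y = extend a i j].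
Proof.
move=> hI kI; rewrite /label; set C := level_prod _ p.+2 _ _ _.
have [->|[j [jq <- ->]]] := level_prod_injective (@qmul M) y C kI; first by left.
rewrite /C; have [->|[i [ip <- ->]]] := level_prod_injective (@col_mul M) x (extend a) hI.
  by left.
by right; exists i, j.
Qed.

(** The label at (h i, k j) is a product having a conjugate of the entry (i, j) among its factors.
    The sets S of interest are {1} and [Q]. *)
Lemma label_factor (S : set M) p q (a : Arr M p q) h k i j :
  (forall u v, S (u * v) -> S u /\ S v) -> (forall u v, S (u ^ v) -> S u) ->
  (i < p.+2)%N -> (j < q.+2)%N -> S (label a h k (h i) (k j)) -> S (extend a i j).
Proof.
move=> SM SJ ip jq; rewrite /label.
have facM (T : Type) (e : T) (op : Monoid.law e) (U : set T) n
    (l : nat -> K) (G : nat -> T) m :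
    (forall u v, U (op u v) -> U u /\ U v) -> (m < n)%N ->
    U (level_prod op n l (l m) G) -> U (G m).
  move=> UM; rewrite /level_prod; elim: n => // n IH.
  rewrite ltnS leq_eqVlt big_ord_recr => /predU1P[->|mn] /= /UM[Ul Ur] //.
    by rewrite eqxx in Ur.
  exact: IH.
(* First the factor of row j is isolated, then the column i inside it: row j of a product of two
   columns is a conjugate of one entry times another. *)
move=> /(facM _ _ (@qmul M) S _ _ _ _ SM jq).
pose U := [set f : nat -> M | S (f j)].
have UM u v : U (col_mul u v) -> U u /\ U v by move=> /SM[/SJ].
exact: (facM _ _ (@col_mul M) U p.+2 h (extend a) i UM ip).
Qed.

End Labels.

(** * Segments in the Hurwitz space *)

Section Segments.
Variables (R : realType) (p : nat).
Local Open Scope ring_scope.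
Implicit Types (s t : simplex R p) (c : R).

(* Clamping the parameter makes segments total functions on the real line. *)
Definition clamp c : R := Num.max 0 (Num.min c 1).

Lemma clamp_itv c : 0 <= clamp c <= 1.
Proof. by rewrite /clamp le_max lexx /= ge_max ler01 ge_min lexx orbT. Qed.

Lemma clamp_continuous : continuous clamp.
Proof.
move=> c; apply: (@continuous_max _ _ (cst 0) (fun c => Num.min c 1)).
  exact: cst_continuous.
by apply: (@continuous_min _ _ id (cst 1)); [exact: cvg_id|exact: cst_continuous].
Qed.

Lemma segment_simplex s t c :
  (1 - clamp c) *: val s + clamp c *: val t \in simplex R p.
Proof.
have /andP[c0 c1] := clamp_itv c.
have [s0 s1] := set_valP s; have [t0 t1] := set_valP t.
apply/mem_set; split=> [i|].
  by rewrite !mxE; apply: addr_ge0; apply: mulr_ge0; rewrite ?subr_ge0.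
under eq_bigr do rewrite !mxE.
by rewrite big_split -!mulr_sumr /= s1 t1 !mulr1 subrK.
Qed.

Definition segment s t c : simplex R p :=
  exist (fun x => x \in simplex R p) _ (segment_simplex s t c).

Lemma segment0 s t : segment s t 0 = s.
Proof.
apply: val_inj; rewrite /= /clamp.
by rewrite min_l ?ler01 // maxxx subr0 scale1r scale0r addr0.
Qed.

Lemma segment1 s t : segment s t 1 = t.
Proof.
apply: val_inj; rewrite /= /clamp.
by rewrite minxx max_r ?ler01 // subrr scale1r scale0r add0r.
Qed.

(** Even when s lies on the boundary, the segment enters the interior at once. *)
Lemma segment_gt0 s t c : 0 < c -> (forall j, 0 < val t ord0 j) ->
  forall j, 0 < val (segment s t c) ord0 j.
Proof.
move=> c0 t0 j; rewrite !mxE.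
have cc : 0 < clamp c by rewrite /clamp lt_max lt_min c0 ltr01 orbT.
have /andP[_ c1] := clamp_itv c; have [s0 _] := set_valP s.
by apply: ltr_wpDl; [apply: mulr_ge0; rewrite ?subr_ge0|apply: mulr_gt0].
Qed.

Lemma segment_le0 s t c : c <= 0 -> segment s t c = s.
Proof.
move=> c0; rewrite -[RHS](segment0 s t); apply: val_inj => /=.
suff -> : clamp c = clamp 0 by [].
by rewrite /clamp !min_l ?ler01 ?(le_trans c0) // maxxx max_l.
Qed.

Lemma segment_continuous s t : continuous (segment s t).
Proof.
apply: continuous_comp_initial => c.
have cc : clamp x @[x --> c] --> clamp c by exact: clamp_continuous.
apply: (@cvgD _ _ _ _ _ (fun c => (1 - clamp c) *: val s) (fun c => clamp c *: val t)).
  by apply: cvgZr_tmp; apply: cvgB => //; exact: cvg_cst.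
exact: cvgZr_tmp.
Qed.

Lemma barycenter_simplex :
  (const_mx p.+1%:R^-1 : 'rV[R]_p.+1) \in simplex R p.
Proof.
apply/mem_set; split=> [i|]; first by rewrite mxE invr_ge0 ler0n.
under eq_bigr do rewrite mxE.
by rewrite sumr_const card_ord -[LHS]mulr_natl divff // pnatr_eq0.
Qed.

Definition barycenter : simplex R p :=
  exist (fun x => x \in simplex R p) _ barycenter_simplex.

Lemma barycenter_gt0 j : 0 < val barycenter ord0 j.
Proof. by rewrite mxE invr_gt0 ltr0n. Qed.

End Segments.

(** * Points of the Hurwitz space and paths between them *)

Section Membership.
Variables (R : realType) (Q : pmqType) (Qh : completion Q).
Local Notation cm := (completion_map Qh).
Local Notation Hw := (@hurwitz R Q Qh).
Local Notation Real := (realization R (Arr Qh)).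

Lemma range_cm1 : range cm 1.
Proof. by have [<- _ _] := completion_map_pmq Qh; exact: imageT. Qed.

(** A gluing changes the array by a face or degeneracy and the positions by the matching [unbump] or
    [bump], so the label function descends to the realisation. *)
Lemma label_point_of p q (a : Arr Qh p q)
    (s : simplex R p) (t : simplex R q)
    p' q' (a' : Arr Qh p' q') (s' : simplex R p') (t' : simplex R q') :
  point_of a s t = point_of a' s' t' :> Real ->
  label a (pos s) (pos t) = label a' (pos s') (pos t').
Proof.
pose lab (y : cells R (Arr Qh)) :=
  label (projT2 y).1 (pos (projT2 y).2.1) (pos (projT2 y).2.2).
move/(congr1 (descend lab)); rewrite !descend_pi //.
all: move=> y z; case=> {p q a s t p' q' a' s' t'} p q i a s t ip; rewrite /lab /=.
all: by [rewrite label_hface // pos_coface|rewrite label_hdeg // pos_codeg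
  |rewrite label_vface // pos_coface|rewrite label_vdeg // pos_codeg].
Qed.

Hypothesis augQ : augmented Q.

Lemma pos_neq p (s : simplex R p) : (forall j, (0 < val s ord0 j)%R) ->
  forall i j, (i < j < p.+2)%N -> pos s i <> pos s j.
Proof. by move=> s0 i j /(pos_lt s0) /lt_eqF/eqP. Qed.

Lemma extend_admissible p q (a : Arr Qh p q) k l : admissible a ->
  range cm (extend a k l) /\
  ([|| k == 0, k >= p.+1, l == 0 | l >= q.+1]%N -> extend a k l = 1).
Proof.
move=> [a1 aQ]; rewrite /extend; case: ifP => [/andP[kp lq]|_].
  split=> // /or4P[/eqP k0|kp1|/eqP l0|lq1]; apply: a1.
  - by left; rewrite k0 (_ : inord 0 = ord0) ?mem_head //; apply: val_inj; rewrite /= inordK.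
  - left; rewrite (_ : inord k = ord_max) ?in_cons ?eqxx ?orbT //.
    by apply: val_inj; rewrite /= inordK //; lia.
  - by right; rewrite l0 (_ : inord 0 = ord0) ?mem_head //; apply: val_inj; rewrite /= inordK.
  - right; rewrite (_ : inord l = ord_max) ?in_cons ?eqxx ?orbT //.
    by apply: val_inj; rewrite /= inordK //; lia.
by split=> //; exact: range_cm1.
Qed.

(** Interior coordinates give distinct positions, so each label is 1 or an entry, and the boundary
    of the square meets only the border of the array. *)
Lemma label_admissible p q (a : Arr Qh p q)
    (s : simplex R p) (t : simplex R q) :
  admissible a -> (forall j, (0 < val s ord0 j)%R) -> (forall j, (0 < val t ord0 j)%R) ->
  forall x y : R, range cm (label a (pos s) (pos t) x y) /\
    ([|| x == 0, x == 1, y == 0 | y == 1]%R -> label a (pos s) (pos t) x y = 1).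
Proof.
move=> adm s0 t0 x y.
have [->|] := label_injective a x y (pos_neq s0) (pos_neq t0).
  by split=> //; exact: range_cm1.
move=> [i [j [ip jq <- <- ->]]].
have [er e1] := extend_admissible i j adm; split=> // xy; apply: e1.
have neq := fun k l h => negP (introN eqP (@pos_neq p s s0 k l h)).
have neqt := fun k l h => negP (introN eqP (@pos_neq q t t0 k l h)).
case/or4P: xy => h.
- have [->//|i0] := eqVneq i 0%N; case: (neq 0%N i); first by lia.
  by rewrite pos0 eq_sym.
- have [//|i0] := leqP p.+1 i; first by rewrite orbT.
  by case: (neq i p.+1); rewrite ?pos_last //; lia.
- have [->|i0] := eqVneq j 0%N; first by rewrite !orbT.
  by case: (neqt 0%N j); rewrite ?pos0 1?eq_sym //; lia.
- have [//|i0] := leqP q.+1 j; first by rewrite !orbT.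
  by case: (neqt j q.+1); rewrite ?pos_last //; lia.
Qed.

(** Here s and t may lie on the boundary. Entries at coinciding positions are, up to conjugation,
    factors of one label; factors of an element of [Q] lie in [Q], and factors of 1 are 1. *)
Lemma admissible_label p q (a : Arr Qh p q) (s : simplex R p) (t : simplex R q) :
  (forall x y : R, range cm (label a (pos s) (pos t) x y) /\
    ([|| x == 0, x == 1, y == 0 | y == 1]%R -> label a (pos s) (pos t) x y = 1)) ->
  admissible a.
Proof.
have extE (k : 'I_p.+2) (l : 'I_q.+2) : extend a k l = a k l.
  by rewrite /extend !ltn_ord !inord_val.
move=> lab; split=> k l; rewrite -extE.
- move=> kl; apply: (@label_factor _ R [set u | u = 1] _ _ a (pos s) (pos t)) => //=.
  + move=> u v; exact: mul_eq1.
  + by move=> u v uv; apply: (@qconj_inj _ v); rewrite /= qconj1x.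
  apply: (lab _ _).2; case: kl; rewrite !inE => /orP[]/eqP -> /=;
  by rewrite ?pos0 ?pos_last eqxx ?orbT.
- apply: (@label_factor _ R (range cm) _ _ a (pos s) (pos t)) => //.
  + by move=> u v; exact: completion_range_mul.
  + by move=> u v /completion_map_conj.
  + exact: (lab _ _).1.
Qed.

(** The condition on labels passes from the given cell to any other cell representing the point,
    whose array is then admissible too. *)
Lemma hurwitz_interior p q (a : Arr Qh p q)
    (s : simplex R p) (t : simplex R q) :
  admissible a -> (forall j, (0 < val s ord0 j)%R) -> (forall j, (0 < val t ord0 j)%R) ->
  point_of a s t \in Hw.
Proof.
move=> adm s0 t0; apply/mem_set => -[p' [q' [a' [s' [t' [na /label_point_of E]]]]]].
by apply/na/(@admissible_label _ _ a' s' t'); rewrite -E; exact: label_admissible.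
Qed.

Lemma hurwitz_admissible p q (a : Arr Qh p q)
    (s : simplex R p) (t : simplex R q) :
  point_of a s t \in Hw -> admissible a.
Proof. by move/set_mem => h; apply: contrapT => na; apply: h; exists p, q, a, s, t. Qed.

(* In particular both z and z' lie in the Hurwitz space. *)
Definition linked (z z' : Real) := exists x y : Hw,
  [/\ val x = z, val y = z' &
      connected_component [set: Hw] x = connected_component setT y].

Lemma linked_refl z : z \in Hw -> linked z z.
Proof. by move=> zH; pose x : Hw := exist _ z zH; exists x, x. Qed.

Lemma linked_sym z z' : linked z z' -> linked z' z.
Proof. by move=> [x [y [xz yz xy]]]; exists y, x. Qed.

Lemma linked_trans z z' z'' : linked z z' -> linked z' z'' -> linked z z''.
Proof.
move=> [x [y [xz <- xy]]] [x' [y' [/val_inj -> yz yy]]].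
by exists x, y'; split=> //; rewrite xy.
Qed.

Definition cell_center p q (a : Arr Qh p q) : Real :=
  point_of a (barycenter R p) (barycenter R q).

Lemma cell_center_hurwitz p q (a : Arr Qh p q) : admissible a -> cell_center a \in Hw.
Proof. by move=> adm; apply: hurwitz_interior => // j; exact: barycenter_gt0. Qed.

(** The segment to the barycentre starts at the given point and is interior to the cell immediately
    afterwards, so it never leaves the Hurwitz space. *)
Lemma linked_cell_center p q (a : Arr Qh p q)
    (s : simplex R p) (t : simplex R q) :
  point_of a s t \in Hw -> linked (point_of a s t) (cell_center a).
Proof.
move=> zH; have adm := hurwitz_admissible zH.
pose ss := segment s (barycenter R p); pose tt := segment t (barycenter R q).
pose seg c : Real := point_of a (ss c) (tt c).
have segH c : seg c \in Hw.
  rewrite /seg /ss /tt; have [c0|c0] := leP c 0%R.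
    by rewrite !segment_le0.
  by apply: hurwitz_interior => //; apply: segment_gt0 => // j; exact: barycenter_gt0.
pose g c : Hw := exist _ (seg c) (segH c).
have gc : continuous g.
  apply: continuous_comp_initial => c U nU.
  have h := @pi_continuous (cells R (Arr Qh)) {eq_quot glue_equiv R (Arr Qh)}%qT
    (cell a (ss c) (tt c)) U nU.
  have h2 := @cell_continuous R (Arr Qh) p q a (ss c, tt c) _ h.
  have h3 := cvg_pair (@segment_continuous R p s (barycenter R p) c)
    (@segment_continuous R q t (barycenter R q) c).
  exact: (h3 _ _ _ _ h2).
exists (g 0%R), (g 1%R); split; rewrite /= /seg /ss /tt ?segment0 ?segment1 //.
(* The clamped path is defined on the whole line, which is connected as an interval. *)
have cg : connected (range g).
  apply: connected_continuous_connected; last exact: continuous_subspaceT.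
  exact/connected_intervalP.
apply: same_connected_component.
by exists (range g) => //; split=> //; exact: imageT.
Qed.

(** The gluing identifies the centre of the face with a boundary point of the cell of a, from which
    a segment leads to the centre of that cell. *)
Lemma linked_hface p q i (a : Arr Qh p.+1 q) : (i <= p.+1)%N ->
  admissible (hface i a) -> linked (cell_center (hface i a)) (cell_center a).
Proof.
move=> ip /cell_center_hurwitz; rewrite /cell_center.
have -> : point_of (hface i a) (barycenter R p) (barycenter R q) =
    point_of a (coface i (barycenter R p)) (barycenter R q).
  exact/cell_glue_pi/glue_hface.
exact: linked_cell_center.
Qed.

Lemma linked_vface p q j (a : Arr Qh p q.+1) : (j <= q.+1)%N ->
  admissible (vface j a) -> linked (cell_center (vface j a)) (cell_center a).
Proof.
move=> jq /cell_center_hurwitz; rewrite /cell_center.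
have -> : point_of (vface j a) (barycenter R p) (barycenter R q) =
    point_of a (barycenter R p) (coface j (barycenter R q)).
  exact/cell_glue_pi/glue_vface.
exact: linked_cell_center.
Qed.

End Membership.

(** * Reduction of arrays to words *)

Section Columns.
Variables (R : realType) (Q : pmqType) (Qh : completion Q).
Local Notation cm := (completion_map Qh).
Local Notation Hw := (@hurwitz R Q Qh).
Implicit Types (f g : nat -> Qh) (s u v : seq (nat -> Qh)).

(** The list s holds the inner columns; the left border is prepended and the right one is the
    default value of [nth]. *)
Definition columns s : nat -> nat -> Qh := nth (fun=> 1) ((fun=> 1) :: s).

(** Triviality is also imposed beyond the border row q+1, so that the inner rows determine f as a
    function. *)
Definition good_column q f : Prop :=
  forall l, range cm (f l) /\ ((l == 0) || (q < l)%N -> f l = 1).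

Definition good_columns q s : bool := all (fun f => `[< good_column q f >]) s.

(** Keeping p apart from [size s] lets equations between sizes be rewritten in the type of the
    array. *)
Definition column_center p q s : realization R (Arr Qh) :=
  cell_center R (array p.+2 q.+2 (columns s) : Arr Qh p q).

Definition config q s := column_center (size s) q s.

Lemma good_column1 q : good_column q (fun=> 1).
Proof. by move=> l; split=> //; exact: range_cm1. Qed.

Lemma good_columns_nth q s k : good_columns q s -> good_column q (columns s k).
Proof.
move=> sq; case: k => [|k]; first exact: good_column1.
rewrite /columns /=; case: (ltnP k (size s)) => ks; last first.
  by rewrite nth_default //; exact: good_column1.
exact/asboolP/(all_nthP _ sq).
Qed.

Lemma good_columns_admissible q s : good_columns q s ->
  admissible (array (size s).+2 q.+2 (columns s) : Arr Qh (size s) q).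
Proof.
move=> sq; split=> k l; rewrite mxE; last exact: (good_columns_nth _ sq _).1.
rewrite !inE => -[]/orP[]/eqP -> //=.
- by rewrite /columns nth_default.
- exact: (good_columns_nth _ sq _).2.
- by apply: (good_columns_nth _ sq _).2; rewrite ltnSn orbT.
Qed.

(** The border column shifts indices by one, whence the index [(size u).+1]. *)
Lemma columns_merge u f g v :
  merge_at (@col_mul Qh) (size u).+1 (columns (u ++ f :: g :: v)) =
  columns (u ++ col_mul f g :: v).
Proof.
apply/funext => k; rewrite /merge_at /columns.
case: k => [|k] //; rewrite ltnS eqSS.
have catE w n : nth (fun=> 1) ((fun=> 1) :: (u ++ w)) (size u + n).+1 =
    nth (fun=> 1) w n :> (nat -> Qh).
  by rewrite /= nth_cat ltnNge leq_addr addKn.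
case: (ltngtP k (size u)) => ku; first by rewrite /= !nth_cat ku.
  have [r ->] : exists r, k = (size u + r.+1)%N by exists (k - (size u).+1)%N; lia.
  by rewrite catE -[(size u + r.+1).+1]addnS catE.
have catE0 w := catE w 0%N; have catE1 w := catE w 1%N.
by rewrite addn0 in catE0; rewrite addn1 in catE1; rewrite ku !catE0 catE1.
Qed.

Lemma columns_map (h : (nat -> Qh) -> (nat -> Qh)) s :
  h (fun=> 1) = (fun=> 1) ->
  (fun k => h (columns s k)) = columns (map h s).
Proof.
move=> h1; apply/funext; case=> [|k]; rewrite /columns //=.
case: (ltnP k (size s)) => ks; first by rewrite (nth_map (fun=> 1)).
by rewrite !nth_default ?size_map.
Qed.

Hypothesis augQ : augmented Q.
Local Notation linked := (@linked R Q Qh).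

Lemma linked_columns q s : good_columns q s -> linked (config q s) (config q s).
Proof.
by move=> /good_columns_admissible/(cell_center_hurwitz R augQ)/linked_refl.
Qed.

Lemma linked_merge_columns q u f g v :
  good_columns q (u ++ col_mul f g :: v) ->
  linked (config q (u ++ col_mul f g :: v)) (config q (u ++ f :: g :: v)).
Proof.
move=> /good_columns_admissible; rewrite /config /column_center.
set p := size (u ++ col_mul f g :: v).
rewrite -/(column_center (size (u ++ f :: g :: v)) q (u ++ f :: g :: v)).
have -> : size (u ++ f :: g :: v) = p.+1 by rewrite /p !size_cat /= addnS.
pose a : Arr Qh p.+1 q := array p.+3 q.+2 (columns (u ++ f :: g :: v)).
have <- : hface (size u).+1 a = array p.+2 q.+2 (columns (u ++ col_mul f g :: v)).
  by rewrite -columns_merge; exact: arr_hface_array.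
apply: (@linked_hface R Q Qh augQ p q (size u).+1 a).
by rewrite /p size_cat /=; lia.
Qed.

Lemma linked_merge_rows q j s : (j <= q.+1)%N ->
  good_columns q (map (merge_at qmul j) s) ->
  linked (config q (map (merge_at qmul j) s)) (config q.+1 s).
Proof.
move=> jq /good_columns_admissible; rewrite /config.
rewrite /column_center size_map.
pose a : Arr Qh (size s) q.+1 := array (size s).+2 q.+3 (columns s).
have <- : vface j a = array (size s).+2 q.+2 (columns (map (merge_at qmul j) s)).
  rewrite -columns_map; first exact: arr_vface_array.
  by apply/funext => l; rewrite /merge_at qmul1x !if_same.
exact: (@linked_vface R Q Qh augQ (size s) q j a).
Qed.

(** * Elimination of rows *)

Definition bottom q f : nat -> Qh := fun l => if l == q then 1 else f l.
Definition top q f : nat -> Qh := fun l => if l == q then f l else 1.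

(** Below row q the conjugating prefix of [top] is trivial, in row q the conjugated entry is 1, and
    above it f is 1. *)
Lemma col_mul_bottom_top q f : good_column q f ->
  col_mul (bottom q f) (top q f) = f.
Proof.
move=> fq; apply/funext => l; rewrite /col_mul /bottom /top.
case: eqP => [lq|/eqP lq]; first by rewrite qconj1x qmul1x.
rewrite qmulx1; have [lq1|lq1] := ltnP q l.
  by rewrite (fq l).2 ?qconj1x // lq1 orbT.
rewrite /prefix_prod big1 ?qconjx1 // => m _.
by case: eqP => // mq; have := ltn_ord m; lia.
Qed.

Lemma good_bottom q f : good_column q f -> good_column q (bottom q f).
Proof.
move=> fq l; rewrite /bottom; case: eqP => // _.
exact: good_column1.
Qed.

Lemma good_top q f : good_column q f -> good_column q (top q f).
Proof.
move=> fq l; rewrite /top; case: eqP => // _.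
exact: good_column1.
Qed.

Definition split_top q s := flatten [seq [:: bottom q f; top q f] | f <- s].

(** The prefix u collects the columns already split; each splitting exhibits the previous array as a
    horizontal face. *)
Lemma linked_split q u s : good_columns q (u ++ s) ->
  linked (config q (u ++ s)) (config q (u ++ split_top q s)).
Proof.
elim: s u => [|f s IH] u us; first exact: linked_columns.
have /and3P[uq /asboolP fq sq] :
    [&& good_columns q u, `[< good_column q f >] & good_columns q s].
  by move: us; rewrite /good_columns all_cat.
apply: (@linked_trans _ _ _ _ (config q (u ++ bottom q f :: top q f :: s))).
  rewrite -{1}(col_mul_bottom_top fq); apply: linked_merge_columns.
  by rewrite col_mul_bottom_top.
have := IH (u ++ [:: bottom q f; top q f]); rewrite -!catA; apply.
rewrite /good_columns !all_cat; apply/and3P; split=> //=; rewrite andbT.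
by apply/andP; split; apply/asboolP; [exact: good_bottom|exact: good_top].
Qed.

(** Neither half of f meets both rows q+1 and q+2, so merging these rows only multiplies by 1 and
    the entries stay in [Q]. *)
Lemma good_merge_split q f : good_column q.+2 f ->
  good_column q.+1 (merge_at qmul q.+1 (bottom q.+2 f)) /\
  good_column q.+1 (merge_at qmul q.+1 (top q.+2 f)).
Proof.
move=> fq; split=> l; rewrite /merge_at /bottom /top.
  case: ltngtP => lq.
  - rewrite ltn_eqF ?ltnS 1?ltnW //; split; first exact: (fq l).1.
    by rewrite orbF => l0; apply: (fq l).2; rewrite l0.
  - rewrite eqSS gtn_eqF //; split; first exact: (fq l.+1).1.
    by move=> _; apply: (fq l.+1).2; rewrite ltnS lq orbT.
  - by rewrite lq (@ltn_eqF q.+1) // eqxx qmulx1; split=> //; exact: (fq _).1.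
case: ltngtP => lq.
- by rewrite ltn_eqF ?ltnS 1?ltnW //; split=> //; exact: range_cm1.
- by rewrite eqSS gtn_eqF //; split=> //; exact: range_cm1.
- by rewrite lq (@ltn_eqF q.+1) // eqxx qmul1x; split=> //; exact: (fq _).1.
Qed.

Lemma linked_drop_row q s : good_columns q.+2 s ->
  exists2 s', good_columns q.+1 s' & linked (config q.+2 s) (config q.+1 s').
Proof.
move=> sq; pose s' := map (merge_at qmul q.+1) (split_top q.+2 s).
have s'q : good_columns q.+1 s'.
  rewrite /s'; elim: s sq {s'} => //= f s IH /andP[/asboolP /good_merge_split[fb ft] /IH ->].
  by rewrite andbT; apply/andP; split; exact/asboolP.
exists s' => //; apply: linked_trans (linked_split (u := [::]) sq) _.
exact/linked_sym/linked_merge_rows.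
Qed.

(* The new row lies between the last nontrivial row and the border row. *)
Lemma linked_add_row q s : good_columns q s -> linked (config q s) (config q.+1 s).
Proof.
move=> sq.
have sE : map (merge_at qmul q.+1) s = s.
  elim: s sq => //= f s IH /andP[/asboolP fq /IH ->]; congr cons.
  apply/funext => l; rewrite /merge_at; case: ltngtP => // lq.
    by rewrite !(fq _).2 //; lia.
  by rewrite lq !(fq _).2 ?qmulx1 //; lia.
by rewrite -{1}sE; apply: linked_merge_rows => //; rewrite sE.
Qed.

(** * Arrays with a single row and moves of words *)

Definition letter a : nat -> Qh := fun l => if l == 1%N then cm a else 1.

Definition row_config (w : seq Q) := config 1 (map letter w).

Lemma good_letter a : good_column 1 (letter a).
Proof.
move=> l; rewrite /letter; case: eqP => [->|_]; last exact: good_column1.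
by split=> //; exact: imageT.
Qed.

Lemma good_letters (w : seq Q) : good_columns 1 (map letter w).
Proof. by apply/allP => f /mapP[a _ ->]; apply/asboolP/good_letter. Qed.

Lemma one_row_letters s : good_columns 1 s -> exists w, s = map letter w.
Proof.
elim: s => [_|f s IH /= /andP[/asboolP f1 /IH[w ->]]]; first by exists [::].
have [[a _ af] _] := f1 1%N; exists (a :: w) => /=; congr cons.
apply/funext => l; rewrite /letter; case: eqP => [->//|l1].
by rewrite (f1 l).2 //; lia.
Qed.

Lemma linked_row q s : good_columns q s -> exists w, linked (config q s) (row_config w).
Proof.
case: q => [|q].
  (* Without inner rows every entry is 1; adding a trivial row gives a word of units. *)
  move=> s0; have l0 := linked_add_row s0.
  have s1 : good_columns 1 s.
    apply/allP => f /(allP s0)/asboolP f0; apply/asboolP => l.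
    by split=> [|l1]; [exact: (f0 l).1|apply: (f0 l).2; lia].
  by have [w sw] := one_row_letters s1; exists w; rewrite /row_config -sw.
elim: q s => [|q IH] s sq.
  have [w sw] := one_row_letters sq; exists w; rewrite /row_config -sw.
  exact: linked_columns.
have [s' s'q ss'] := linked_drop_row sq.
by have [w s'w] := IH _ s'q; exists w; exact: linked_trans s'w.
Qed.

Lemma linked_row_config p q (a : Arr Qh p q) : admissible a ->
  exists w, linked (cell_center R a) (row_config w).
Proof.
(* Inner columns start at index 1, column 0 being the border. *)
move=> adm; pose s := [seq extend a k.+1 | k <- iota 0 p].
have sE : columns s = extend a.
  apply/funext => k; apply/funext => l; rewrite /columns.
  case: k => [|k] /=; first by rewrite (extend_admissible 0 l adm).2.
  case: (ltnP k p) => kp; first by rewrite (nth_map 0%N) ?size_iota // nth_iota.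
  rewrite nth_default ?size_map ?size_iota //.
  by rewrite (extend_admissible k.+1 l adm).2 // ltnS kp orbT.
have sp : size s = p by rewrite size_map size_iota.
have sq : good_columns q s.
  apply/allP => f /mapP[k _ ->]; apply/asboolP => l.
  have [er e1] := extend_admissible k.+1 l adm; split=> // lq; apply: e1.
  by case/orP: lq => ->; rewrite !orbT.
have [w aw] := linked_row sq; exists w.
by move: aw; rewrite /config sp /column_center sE array_extend.
Qed.

(** The shorter array is the face absorbing the trivial column into its left neighbour. This
    realises the dropping of a letter 1. *)
Lemma linked_drop_column q u v : good_columns q (u ++ v) ->
  linked (config q (u ++ v)) (config q (u ++ (fun=> 1) :: v)).
Proof.
move=> /good_columns_admissible; rewrite /config {1}/column_center.
set p := size (u ++ v).
have -> : size (u ++ (fun=> 1) :: v) = p.+1 by rewrite /p !size_cat /= addnS.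
pose a : Arr Qh p.+1 q := array p.+3 q.+2 (columns (u ++ (fun=> 1) :: v)).
have aE : columns (u ++ (fun=> 1) :: v) =
    insert_after (fun=> 1) (size u) (columns (u ++ v)).
  apply/funext => k; rewrite /insert_after /columns; case: k => [|k] //=.
  rewrite eqSS !nth_cat; case: (ltngtP k (size u)) => ku //; last by rewrite ku subnn.
  case: k ku => // k; rewrite ltnS => ku.
  by rewrite /= nth_cat ltnNge ku /= subSn.
have <- : hface (size u) a = array p.+2 q.+2 (columns (u ++ v)).
  have h := merge_insert_eq (@col_mul1r Qh) (size u) (columns (u ++ v)).
  by rewrite -[in RHS]h -aE; exact: arr_hface_array.
apply: (@linked_hface R Q Qh augQ p q (size u) a).
by rewrite /p size_cat; lia.
Qed.

Lemma prefix_prod_1 f : prefix_prod f 1 = f 0%N.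
Proof. by rewrite prefix_prodS prefix_prod0 qmul1x. Qed.

Definition second_row a : nat -> Qh := fun l => if l == 2%N then cm a else 1.

Lemma linked_word_step (w w' : seq Q) : word_step w w' ->
  linked (row_config w) (row_config w').
Proof.
have [cm1 cmJ cmM] := completion_map_pmq Qh.
case=> {w w'} u v => [|a b c abc|a b]; rewrite /row_config !map_cat /=.
- have -> : letter 1 = fun=> 1 by apply/funext => l; rewrite /letter cm1 if_same.
  by apply/linked_sym/linked_drop_column; rewrite -map_cat; exact: good_letters.
- have E : col_mul (letter a) (letter b) = letter c.
    apply/funext => -[|[|l]]; rewrite /col_mul /letter /=.
    + by rewrite qconj1x qmulx1.
    + by rewrite prefix_prod_1 qconjx1; have := cmM _ _ _ abc; rewrite qpmulE => -[].
    + by rewrite qconj1x qmulx1.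
  rewrite -E; apply/linked_sym/linked_merge_columns; rewrite E.
  by rewrite -[letter c :: _]/(map letter (c :: v)) -map_cat; exact: good_letters.
pose m1 := @merge_at Qh qmul 1.
have m1l x : m1 (letter x) = letter x.
  by apply/funext => -[|[|l]]; rewrite /m1 /merge_at /letter /= ?qmulx1.
have m1s x : m1 (second_row x) = letter x.
  by apply/funext => -[|[|l]]; rewrite /m1 /merge_at /letter /second_row /= ?qmul1x.
have m1L w : map m1 (map letter w) = map letter w.
  by rewrite -map_comp; apply: eq_map.
(* Both sides are the column with b in row 1 and a^b in row 2; its entries lie in [Q] even when ab
   is undefined. *)
have E : col_mul (second_row a) (letter b) = col_mul (letter b) (second_row (a ^ b)).
  apply/funext => -[|[|[|l]]]; rewrite /col_mul /letter /second_row /=.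
  + by rewrite !qconj1x.
  + by rewrite !prefix_prod_1 /= qconj1x qmul1x qmulx1 qconjx1.
  + by rewrite prefix_prodS prefix_prod_1 /= qmul1x qmulx1 qconj1x qmul1x cmJ.
  + by rewrite !qconj1x.
have rowsE x y : map m1 (map letter u ++ x :: y :: map letter v) =
    map letter u ++ m1 x :: m1 y :: map letter v.
  by rewrite map_cat /= !m1L.
have good2 x : good_column 2 (letter x).
  move=> l; split; first exact: (good_letter x l).1.
  by move=> l2; apply: (good_letter x l).2; lia.
have goodw w : good_columns 2 (map letter w).
  by apply/allP => f /mapP[x _ ->]; apply/asboolP/good2.
have goodK : good_columns 2
    (map letter u ++ col_mul (second_row a) (letter b) :: map letter v).
  rewrite /good_columns all_cat; apply/and3P; split; [exact: goodw| |exact: goodw].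
  apply/asboolP => -[|[|[|l]]]; rewrite /col_mul /letter /second_row /=.
  + by rewrite qconj1x qmulx1; split=> //; exact: range_cm1.
  + by rewrite qconj1x qmul1x; split=> //; exact: imageT.
  + rewrite prefix_prodS prefix_prod_1 /= qmul1x qmulx1 -cmJ; split=> //.
    exact: imageT.
  + by rewrite qconj1x qmulx1; split=> //; exact: range_cm1.
(* The path lifts a to the second row, merges the two columns, splits the result in the other order
   and lowers a^b to the first row. *)
apply: (@linked_trans _ _ _ _
  (config 2 (map letter u ++ second_row a :: letter b :: map letter v))).
  rewrite -{1}(m1s a) -{1}(m1l b) -rowsE; apply: linked_merge_rows => //.
  rewrite rowsE m1s m1l -[letter a :: _]/(map letter (a :: b :: v)) -map_cat.
  exact: good_letters.
apply: (linked_trans (linked_sym (linked_merge_columns goodK))).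
rewrite E in goodK *; apply: (linked_trans (linked_merge_columns goodK)).
apply: linked_sym; rewrite -{1}(m1s (a ^ b)) -{1}(m1l b) -rowsE.
apply: linked_merge_rows => //.
rewrite rowsE m1s m1l -[letter b :: _]/(map letter (b :: a ^ b :: v)) -map_cat.
exact: good_letters.
Qed.

Lemma linked_word_eq (w w' : seq Q) : word_eq w w' ->
  linked (row_config w) (row_config w').
Proof.
elim=> {w w'} [w w'|w|w w' _|w w' w'' _ + _] .
- exact: linked_word_step.
- exact/linked_columns/good_letters.
- exact: linked_sym.
- exact: linked_trans.
Qed.

Lemma total_prod_row (w : seq Q) p : p = size w ->
  total_prod (array p.+2 3 (columns (map letter w)) : Arr Qh p 1%N) =
  word_prod Qh w.
Proof.
move=> ->; rewrite total_prod_array.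
have -> : (fun k => prefix_prod (columns (map letter w) k) 3) = nth 1 (1 :: map cm w).
  apply/funext => k; rewrite !prefix_prodS prefix_prod0 qmul1x.
  case: k => [|k]; rewrite /columns /= ?qmulx1 //.
  case: (ltnP k (size w)) => kw; last first.
    by rewrite !nth_default ?size_map ?qmulx1.
  (* A letter to serve as the default for [nth_map]. *)
  have [a _] : exists2 a : Q, True & True by exists 1.
  by rewrite !(nth_map a) // /letter /= qmul1x qmulx1.
rewrite prefix_prodS nth_default ?qmulx1; last by rewrite /= size_map.
rewrite /prefix_prod big_ord_recl /= qmul1x /word_prod -(big_map cm xpredT id).
by rewrite (big_nth 1) big_mkord size_map.
Qed.

End Columns.

(** * Connected components *)

Lemma discrete_component (T : choiceType) (x : discrete_topology T) :
  connected_component setT x = [set x].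
Proof. exact: (zero_dimension_totally_disconnected discrete_zero_dimension). Qed.

Lemma component_discrete_map (T : topologicalType) (U : choiceType)
    (f : T -> discrete_topology U) (x y : T) : continuous f ->
  connected_component setT x y -> f y = f x.
Proof.
move=> cf xy; suff : connected_component [set: discrete_topology U] (f x) (f y).
  by rewrite discrete_component.
have cfC : connected (f @` connected_component setT x).
  apply: connected_continuous_connected; first exact: component_connected.
  exact: continuous_subspaceT.
apply: (@connected_component_max _ _ (f @` connected_component setT x)) => //.
by exists x => //; exact: connected_component_refl.
Qed.

Lemma components_map_discrete (T : topologicalType) (U : choiceType)
    (f : T -> discrete_topology U) (x : T) : continuous f ->
  components_map f (connected_component setT x) = [set f x].
Proof.
move=> cf; rewrite /components_map; apply/seteqP; split=> [u [y xy]|_ ->].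
  by rewrite discrete_component (component_discrete_map cf xy).
by exists x; rewrite ?discrete_component //; exact: connected_component_refl.
Qed.

(** Both points are linked to words whose products are their gradings; equal products give words
    related by moves, and moves are realised inside the Hurwitz space. *)
Lemma hurwitz_connected (R : realType) (Q : pmqType) (Qh : completion Q)
    (x y : Hur R Qh) : augmented Q ->
  hurwitz_grading x = hurwitz_grading y ->
  connected_component [set: Hur R Qh] x = connected_component setT y.
Proof.
move=> augQ xy.
have row (z : Hur R Qh) : exists w, linked (val z) (row_config R Qh w) /\
    hurwitz_grading z = word_prod Qh w.
  have [p [q [a [s [t zE]]]]] : exists p q (a : Arr Qh p q) s t, val z = point_of a s t.
    elim/realization_ind: (val z) => p q a s t.
    by exists p, q, a, s, t.
  have zH : point_of a s t \in @hurwitz R Q Qh by rewrite -zE; exact: (valP z).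
  have [w aw] := linked_row_config R augQ (hurwitz_admissible zH).
  have zw := linked_trans (linked_cell_center augQ zH) aw.
  exists w; split; first by move: zw; rewrite -zE.
  (* The grading is constant on components, so it can be computed at the centre of the single-row
     cell. *)
  have [x' [y' [x'z y'w xy']]] := zw.
  rewrite -zE in x'z; rewrite -(val_inj x'z).
  have <- : hurwitz_grading y' = word_prod Qh w.
    rewrite (hurwitz_gradingE y'w); apply: total_prod_row; exact: size_map.
  apply/esym; apply: component_discrete_map; first exact: hurwitz_grading_continuous.
  by rewrite xy'; exact: connected_component_refl.
have [w [xw gx]] := row x; have [w' [yw' gy]] := row y.
have /word_prod_eq ww' : word_prod Qh w = word_prod Qh w' by rewrite -gx -gy.
have [x' [y' [/val_inj <- /val_inj <- //]]] :=
  linked_trans xw (linked_trans (linked_word_eq R Qh augQ ww') (linked_sym yw')).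
Qed.

Theorem theorem7 (R : realType) (Q : pmqType) (Qh : completion Q) :
  augmented Q ->
  [/\ crossed_map (@total_monodromy R Q Qh),
      forall f : Hur R Qh -> discrete_crossed Qh,
        crossed_map f -> f = @total_monodromy R Q Qh
    & set_bij (components (Hur R Qh)) (components (discrete_crossed Qh))
        (components_map (@total_monodromy R Q Qh))].
Proof.
move=> augQ; split.
- split=> //; [exact: hurwitz_grading_continuous|exact: hurwitz_grading_act].
(* The grading of the discrete crossed space is the identity, so preserving gradings determines
   f. *)
- by move=> f [_ fg _]; apply/funext => x; exact: fg.
have mapE (x : Hur R Qh) : components_map (@total_monodromy R Q Qh)
    (connected_component setT x) = [set total_monodromy x].
  exact/components_map_discrete/hurwitz_grading_continuous.
split.
- move=> _ [x _ <-]; rewrite mapE; exists (total_monodromy x) => //.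
  exact: discrete_component.
- move=> _ _ /set_mem[x _ <-] /set_mem[y _ <-]; rewrite !mapE => E.
  apply: hurwitz_connected => //.
  by have : [set total_monodromy x] (total_monodromy x) by []; rewrite E.
(* The preimage of b is the component of the centre of the single-row array spelling a word with
   product b. *)
- move=> _ [b _ <-]; have [w wb] := word_prod_surj b.
  have adm := good_columns_admissible (good_letters Qh w).
  have zH := cell_center_hurwitz R augQ adm.
  pose z : Hur R Qh := exist (fun z => z \in @hurwitz R Q Qh) _ zH.
  exists (connected_component setT z); first by exists z.
  rewrite mapE [RHS](@discrete_component Qh b); congr [set _].
  rewrite /total_monodromy (@hurwitz_gradingE _ _ _ z _ _ _ _ _ erefl).
  by rewrite total_prod_row ?size_map.
Qed.
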